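(* Let $G=(V,E)$ be a finite bridgeless graph (loops and multiple edges allowed). Then $\varphi(G,q)$ is a polynomial function of degree $n(G)$ of positive integers $q$, and $\bar\varphi(G,q)$ is a polynomial function of degree $n(G)$ of nonnegative integers $q$; denoting the corresponding polynomials by $\varphi(G,t)$ and $\bar\varphi(G,t)$, they satisfy the reciprocity law \[\varphi(G,-t)=(-1)^{n(G)}\bar\varphi(G,t).\] Moreover, \[\varphi(G,t)=\sum_{\rho\in[\mathcal O_{\mathrm{tc}}(G)]}\varphi_\rho(G,t),\qquad \bar\varphi(G,t)=\sum_{\rho\in[\mathcal O_{\mathrm{tc}}(G)]}\bar\varphi_\rho(G,t).\] In particular, $|\varphi(G,-1)|$ equals the number of totally cyclic orientations on $G$, and $|\varphi(G,0)|$ equals the number of Eulerian equivalence classes of totally cyclic orientations on $G$.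
   Context: An orientation of $G$ assigns to each non-loop edge one of its two possible directions (an arrow from one end-vertex to the other) and to each loop one of its two possible directions; formally $\varepsilon(v,e)\in\{\pm1\}$ records whether $e$ points out of ($+1$) or into ($-1$) the end-vertex $v$ of a non-loop edge, and $\varepsilon(v,e)=0$ if $v$ is not an end-vertex of $e$. Let $\mathcal O(G)$ be the set of orientations. For an orientation $\varepsilon$ and abelian group $A$, an $A$-flow of $(G,\varepsilon)$ is $f:E\to A$ with $\sum_{e}m_{v,e}f(e)=0$ for all $v\in V$, where $m_{v,e}=\varepsilon(v,e)$ for non-loop edges and $m_{v,e}=0$ for loops; $F(G,\varepsilon;A)$ is the group of $A$-flows. A flow is nowhere-zero if $f(e)\ne0$ for all $e$. For a positive integer $q$, $\varphi(G,q)$ is the number of nowhere-zero flows of $(G,\varepsilon)$ with values in an abelian group of order $q$ (this is independent of $\varepsilon$ and of the group). $n(G)=|E|-|V|+c(G)$, where $c(G)$ is the number of connected components. A cut is a nonempty edge set $[S,S^c]$ of all edges between a nonempty proper vertex subset $S$ and its complement; it is directed in an orientation if all its edges point from $S$ to $S^c$, or all point from $S^c$ to $S$. An orientation is totally cyclic if it has no directed cut; $\mathcal O_{\mathrm{tc}}(G)$ is the set of totally cyclic orientations. A digraph is directed Eulerian if at every vertex in-degree equals out-degree (a loop contributes one of each). Two orientations $\varepsilon_1,\varepsilon_2$ are Eulerian equivalent ($\varepsilon_1\sim\varepsilon_2$) if the spanning subgraph with edge set $\{e: \varepsilon_1,\varepsilon_2 \text{ differ on } e\}$ is directed Eulerian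 with respect to $\varepsilon_1$ (equivalently $\varepsilon_2$). This is an equivalence relation, and its classes meeting $\mathcal O_{\mathrm{tc}}(G)$ lie inside $\mathcal O_{\mathrm{tc}}(G)$; $[\mathcal O_{\mathrm{tc}}(G)]$ denotes a set containing exactly one representative of each Eulerian equivalence class of totally cyclic orientations. For an orientation $\rho$ and integer $q$, $\varphi_\rho(G,q)=\#\{f\in F(G,\rho;\mathbb Z): 0<f(e)<q\ \forall e\}$ and $\bar\varphi_\rho(G,q)=\#\{f\in F(G,\rho;\mathbb Z): 0\le f(e)\le q\ \forall e\}$; for $\rho$ totally cyclic these are polynomial functions of $q$ (for $q\ge1$, resp. $q\ge0$), whose polynomials are denoted $\varphi_\rho(G,t),\bar\varphi_\rho(G,t)$. Finally $\bar\varphi(G,q)=\#\{(\rho,f): \rho\in[\mathcal O_{\mathrm{tc}}(G)],\ f\in F(G,\rho;\mathbb Z),\ 0\le f(e)\le q\ \forall e\}$. *)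

(* Defs.v *)
From HB Require Import structures.
From mathcomp Require Import all_boot all_order all_algebra.
Set Implicit Arguments. Unset Strict Implicit. Unset Printing Implicit Defensive.
Import Order.TTheory GRing.Theory Num.Theory.
Local Open Scope ring_scope.

(* A finite multigraph (loops and parallel edges allowed): vertex type V, edge
   type E, and each edge e has two end-vertices [src e] and [dst e]
   (a loop has src e = dst e).  These ends only serve as a reference labelling;
   an orientation chooses for each edge one of its two directions. *)

Section Graph.
Variables (V E : finType) (src dst : E -> V).

(* orientation: o e = true  means e points from src e to dst e,
                o e = false means e points from dst e to src e.
   (For a loop both values are still two distinct orientations.) *)
Definition orientation := {ffun E -> bool}.

Definition otail (o : orientation) (e : E) : V := if o e then src e else dst e.
Definition ohead (o : orientation) (e : E) : V := if o e then dst e else src e.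

Definition is_loop (e : E) : bool := src e == dst e.

Definition inc (o : orientation) (v : V) (e : E) : int :=
  if is_loop e then 0
  else if otail o e == v then 1
  else if ohead o e == v then -1 else 0.

Definition is_flow (A : zmodType) (o : orientation) (f : E -> A) : bool :=
  [forall v : V, \sum_(e : E) f e *~ inc o v e == 0].

Definition nzflow_count (A : finZmodType) (o : orientation) : nat :=
  #|[set f : {ffun E -> A} | is_flow o f & [forall e, f e != 0]]|.

Definition adj (P : pred E) : rel V :=
  fun x y => [exists e, P e && (((src e == x) && (dst e == y)) ||
                                ((src e == y) && (dst e == x)))].
Definition ncomp_sub (P : pred E) : nat := n_comp (connect (adj P)) [pred x : V | true].
Definition ncomp : nat := ncomp_sub predT.

Definition cyclo : nat := (#|E| + ncomp - #|V|)%N.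

Definition is_bridge (e : E) : bool := (ncomp < ncomp_sub (predC1 e))%N.
Definition bridgeless : Prop := forall e, ~~ is_bridge e.

Definition crossing (S : {set V}) (e : E) : bool := (src e \in S) != (dst e \in S).
Definition is_cut (S : {set V}) : bool :=
  [&& S != set0, S != [set: V] & [exists e, crossing S e]].
Definition directed_cut (o : orientation) (S : {set V}) : bool :=
  is_cut S &&
  ([forall e, crossing S e ==> (otail o e \in S)] ||
   [forall e, crossing S e ==> (ohead o e \in S)]).
Definition totally_cyclic (o : orientation) : bool :=
  ~~ [exists S : {set V}, directed_cut o S].
Definition tc_set : {set orientation} := [set o | totally_cyclic o].

Definition directed_eulerian_sub (o : orientation) (D : pred E) : bool :=
  [forall v : V, #|[set e | D e & otail o e == v]| == #|[set e | D e & ohead o e == v]|].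
Definition eul_equiv (o1 o2 : orientation) : bool :=
  directed_eulerian_sub o1 (fun e => o1 e != o2 e).
Definition eul_class (o : orientation) : {set orientation} := [set o' | eul_equiv o o'].
Definition n_tc_classes : nat := #|[set eul_class o | o in tc_set]|.

Definition tc_reps (R : {set orientation}) : Prop :=
  R \subset tc_set /\
  forall o, o \in tc_set -> exists! r, r \in R /\ eul_equiv o r.

Definition phi_rho (rho : orientation) (q : nat) : nat :=
  #|[set f : {ffun E -> 'I_q} |
      is_flow rho (fun e => ((f e : nat)%:Z)) & [forall e, 0 < (f e : nat)]%N]|.

Definition phibar_rho (rho : orientation) (q : nat) : nat :=
  #|[set f : {ffun E -> 'I_q.+1} | is_flow rho (fun e => ((f e : nat)%:Z))]|.

Definition phibar (R : {set orientation}) (q : nat) : nat :=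
  (\sum_(rho in R) phibar_rho rho q)%N.

End Graph.

(* Main.v *)
(* Write [cyc B] for the cyclomatic number of the edge set [B].  Adding an edge to [B] either
   closes a cycle, which carries an integer flow with values in {-1, 0, 1}, or forces
   every flow to vanish on that edge; hence there are |A|^(cyc B) flows supported on [B], and
   inclusion-exclusion gives phi(G,q) = \sum_Z (-1)^|Z| q^(cyc (E - Z)).

   Rounding along such cycles shows that an integer flow can be approximated by [q] times
   an integer flow with error less than [q].  Hence every face of the polytope of
   flows with values in [0,1] of an orientation contains a 0-1 flow [w].  A flow in the
   [q]-th dilate of the face either lies on a smaller face missing [w], or remains in the
   (q-1)-st dilate after subtracting [w]; this difference equation gives polynomiality by induction on the faces.

   Reducing modulo [q], the pairs (rho, f) of a representative and a flow with 0 <= f <= q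
   lying over a given Z/q-flow [g] correspond to the sign patterns on the zero set of [g]
   of integer flows of G.  Deletion-restriction counts the sign patterns on [D] as
   \sum_(Z <= D) (-1)^(|Z| + cyc E - cyc (E - Z)).  Summing over [g] gives
   \bar\varphi(G,q) = \sum_Z (-1)^(|Z| + cyc E - cyc (E - Z)) q^(cyc (E - Z)), which is the
   reciprocity law; nowhere-zero [g] have exactly one such pattern. *)

Require Import Defs.
From HB Require Import structures.
From mathcomp Require Import all_boot all_order all_algebra.
From mathcomp Require Import boolp zify ring.
Set Implicit Arguments. Unset Strict Implicit. Unset Printing Implicit Defensive.
Import Order.TTheory GRing.Theory Num.Theory.
Local Open Scope ring_scope.

(** * Polynomials and inclusion-exclusion *)

Lemma set_ind (T : finType) (P : {set T} -> Prop) :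
  P set0 -> (forall (B : {set T}) e, e \notin B -> P B -> P (e |: B)) -> forall B, P B.
Proof.
move=> P0 PU B; elim: {B}_.+1 {-2}B (ltnSn #|B|) => // n IH B.
have [->//|[e eB]] := set_0Vmem B.
by rewrite (cardsD1 e) eB -{2}(setD1K eB) => lt; apply: PU (IH _ _); rewrite ?setD11.
Qed.

Lemma big_subsetU1 (R : Type) (idx : R) (op : Monoid.com_law idx) (T : finType)
    (S : {set T}) t (F : {set T} -> R) : t \notin S ->
  \big[op/idx]_(J : {set T} | J \subset t |: S) F J =
  op (\big[op/idx]_(J : {set T} | J \subset S) F J)
     (\big[op/idx]_(J : {set T} | J \subset S) F (t |: J)).
Proof.
move=> tS; rewrite (bigID (fun J : {set T} => t \notin J)) /=; congr (op _ _).
  apply: eq_bigl => J; apply/andP/idP => [[JS tJ]|JS].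
    by rewrite -(setU1K tS); apply/subsetD1P.
  split; first exact: subset_trans JS (subsetU1 _ _).
  by apply: contra tS => /(subsetP JS).
rewrite (reindex_onto (fun J => t |: J) (fun J => J :\ t)) /= => [|J /andP[_ tJ]].
  apply: eq_bigl => J; rewrite setU11 andbT; apply/andP/idP.
    move=> [JS /eqP <-]; rewrite -(setU1K tS); exact: setSD.
  move=> JS; split; first exact: setUS.
  by rewrite setU1K //; apply: contra tS => /(subsetP JS).
by rewrite setD1K // -(negbK (t \in J)).
Qed.

(** [S] stays general in the induction: the subsets of [t |: H] containing [t] contribute, with a
    minus sign, the same sum over those elements of [S] that satisfy [t]. *)
Lemma inclusion_exclusion (R : pzRingType) (X T : finType) (sat : X -> T -> bool)
    (S : {set X}) (H : {set T}) :
  #|[set x in S | [forall t in H, ~~ sat x t]]|%:R =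
  \sum_(A : {set T} | A \subset H)
     (-1) ^+ #|A| * #|[set x in S | [forall t in A, sat x t]]|%:R :> R.
Proof.
elim/set_ind: H S => [|H t tH IH] S.
  rewrite (big_pred1 set0) => [|A]; last by rewrite subset0.
  rewrite cards0 mul1r; congr _%:R; apply: eq_card => x; rewrite !inE.
  by congr (_ && _); apply: eq_forallb => t; rewrite !inE.
have allU (P : pred T) (A : {set T}) :
    [forall u in t |: A, P u] = P t && [forall u in A, P u].
  apply/forall_inP/andP => [h|[Pt /forall_inP h] u].
    by split; [apply: h; rewrite setU11 | apply/forall_inP => u uA; apply: h; rewrite setU1r].
  by rewrite !inE => /orP[/eqP ->|/h].
rewrite big_subsetU1 //= -IH.
have -> : \sum_(A : {set T} | A \subset H) (-1) ^+ #|t |: A| *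
      #|[set x in S | [forall u in t |: A, sat x u]]|%:R =
    - \sum_(A : {set T} | A \subset H) (-1) ^+ #|A| *
      #|[set x in [set x in S | sat x t] | [forall u in A, sat x u]]|%:R :> R.
  rewrite -sumrN; apply: eq_bigr => A AH.
  rewrite cardsU1 (contra (subsetP AH t) tH) exprS -mulrA mulN1r.
  by congr (- (_ * _%:R)); apply: eq_card => x; rewrite !inE allU andbA.
rewrite -IH; apply/esym/eqP; rewrite subr_eq -natrD; apply/eqP; congr _%:R.
rewrite -(cardsID [set x | sat x t] [set x in S | [forall u in H, ~~ sat x u]]) addnC.
congr (_ + _)%N; apply: eq_card => x; rewrite !inE ?allU.
  by rewrite andbCA.
by rewrite andbAC.
Qed.

Lemma poly_antidifference (p : {poly rat}) :
  exists P : {poly rat}, forall x, P.[x + 1] - P.[x] = p.[x].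
Proof.
elim: {p}(size p) {-2}p (leqnn (size p)) => [|n IH] p sp.
  exists 0 => x; move: sp; rewrite leqn0 size_poly_eq0 => /eqP ->.
  by rewrite !horner0 subrr.
(* [d] is (X + 1)^(n+1) - X^(n+1), of degree n with leading coefficient n + 1, so [c *: d] cancels
   the coefficient of degree n in [p]. *)
pose c := p`_n / n.+1%:R.
pose d : {poly rat} := \sum_(i < n.+1) 'X^i *+ 'C(n.+1, i).
have [|P PE] := IH (p - c *: d).
  apply/leq_sizeP => j nj; rewrite coefB coefZ coef_sum big_ord_recr /= big1 => [|i _].
    rewrite coefMn coefXn add0r binSn; have [->|jn] := eqVneq j n.
      by rewrite /c mulfVK ?subrr // pnatr_eq0.
    rewrite mul0rn mulr0 subr0; apply: (leq_sizeP _ _ sp).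
    by rewrite ltn_neqAle eq_sym jn.
  by rewrite coefMn coefXn (gtn_eqF (leq_trans (ltn_ord i) nj)) mul0rn.
exists (P + c *: 'X^(n.+1)) => x.
have dE : (x + 1) ^+ n.+1 - x ^+ n.+1 = d.[x].
  rewrite exprD1n big_ord_recr /= binn addrK horner_sum; apply: eq_bigr => i _.
  by rewrite hornerMn hornerXn.
rewrite !(hornerD, hornerZ, hornerXn) opprD addrACA PE -mulrBr dE.
by rewrite hornerD hornerN hornerZ subrK.
Qed.

(** The difference is prescribed at [q.+1] because counts on faces are in general polynomial only at
    positive arguments; the resulting [P] is still correct at 0. *)
Lemma poly_of_difference (L : nat -> rat) (p : {poly rat}) :
  (forall q, L q.+1 - L q = p.[q.+1%:R]) ->
  exists P : {poly rat}, forall q, L q = P.[q%:R].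
Proof.
move=> Lp; have [P PE] := poly_antidifference (p \Po ('X + 1)).
exists (P + (L 0%N - P.[0])%:P); elim=> [|q IH]; first by rewrite hornerD hornerC addrC subrK.
have := Lp q; have := PE q%:R; rewrite horner_comp hornerD hornerX hornerC natr1.
move=> <- /eqP; rewrite subr_eq => /eqP ->; rewrite IH !hornerD !hornerC; ring.
Qed.

(** Agreement from 2 on suffices; these are the moduli for which ['I_m.+2] serves as Z/q. *)
Lemma eq_poly_nat (P Q : {poly rat}) :
  (forall n, P.[n.+2%:R] = Q.[n.+2%:R]) -> P = Q.
Proof.
move=> PQ; apply/eqP; rewrite -subr_eq0; apply/eqP.
apply: (@roots_geq_poly_eq0 _ _ [seq i.+2%:R | i <- iota 0 (size (P - Q))]).
- by apply/allP => _ /mapP[i _ ->]; rewrite rootE !hornerE PQ subrr.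
- rewrite map_inj_uniq ?iota_uniq // => i j /eqP.
  by rewrite eqr_nat => /eqP[].
- by rewrite size_map size_iota.
Qed.

(** * Flows in reference coordinates *)

Section Flows.
Variables (V E : finType) (src dst : E -> V).
Implicit Types (A : zmodType) (B D Z : {set E}) (e : E) (v : V).

(** Incidence for the reference direction from [src] to [dst]; on a loop the two terms cancel. *)
Definition refinc v e : int := (src e == v)%:R - (dst e == v)%:R.
Definition bd A (f : E -> A) v : A := \sum_e f e *~ refinc v e.
Definition flow A (f : E -> A) : bool := [forall v, bd f v == 0].

Lemma flowP A (f : E -> A) : reflect (forall v, bd f v = 0) (flow f).
Proof. by apply: (iffP forallP) => h v; apply/eqP. Qed.

Lemma eq_bd A (f g : E -> A) v : f =1 g -> bd f v = bd g v.
Proof. by move=> fg; apply: eq_bigr => e _; rewrite fg. Qed.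

Lemma eq_flow A (f g : E -> A) : f =1 g -> flow f = flow g.
Proof. by move=> fg; apply: eq_forallb => v; rewrite (eq_bd v fg). Qed.

Lemma bdD A (f g : E -> A) v : bd (fun e => f e + g e) v = bd f v + bd g v.
Proof. by rewrite -big_split; apply: eq_bigr => e _; rewrite mulrzDl. Qed.

Lemma bdN A (f : E -> A) v : bd (fun e => - f e) v = - bd f v.
Proof. by rewrite -sumrN; apply: eq_bigr => e _; rewrite mulNrz. Qed.

Lemma flow0 A : flow (fun=> 0 : A).
Proof. by apply/flowP => v; apply: big1 => e _; rewrite mul0rz. Qed.

Lemma flowD A (f g : E -> A) : flow f -> flow g -> flow (fun e => f e + g e).
Proof. by move=> /flowP hf /flowP hg; apply/flowP => v; rewrite bdD hf hg addr0. Qed.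

Lemma flowN A (f : E -> A) : flow f -> flow (fun e => - f e).
Proof. by move=> /flowP hf; apply/flowP => v; rewrite bdN hf oppr0. Qed.

Lemma flowB A (f g : E -> A) : flow f -> flow g -> flow (fun e => f e - g e).
Proof. by move=> hf hg; apply: flowD hf (flowN hg). Qed.

Lemma flow_mulrz A (a : A) (x : E -> int) : flow x -> flow (fun e => a *~ x e).
Proof.
move=> /flowP hx; apply/flowP => v; rewrite /bd.
under eq_bigr do rewrite -mulrzA.
rewrite -mulrz_sumr; have -> : \sum_e x e * refinc v e = bd x v.
  by apply: eq_bigr => e _; rewrite mulrzz.
by rewrite hx mulr0z.
Qed.

Lemma flowMl (k : int) (x : E -> int) : flow x -> flow (fun e => k * x e).
Proof. by move/(flow_mulrz k); rewrite (eq_flow (g := fun e => k * x e)) // => e; rewrite mulrzz. Qed.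

Lemma flow_div (k : int) (x : E -> int) : k != 0 -> flow (fun e => k * x e) -> flow x.
Proof.
move=> k0 /flowP hx; apply/flowP => v; apply: (mulfI k0); rewrite mulr0 -(hx v).
by rewrite mulr_sumr; apply: eq_bigr => e _; rewrite !mulrzz mulrA.
Qed.

Lemma flow_sum (I : finType) A (x : I -> E -> A) :
  (forall i, flow (x i)) -> flow (fun e => \sum_i x i e).
Proof.
move=> hx; apply/flowP => v; rewrite /bd.
under eq_bigr do rewrite mulrz_suml.
by rewrite exchange_big big1 // => i _; apply: (flowP _ (hx i)).
Qed.

Lemma bd_delta e v : bd (fun e' => (e' == e)%:R : int) v = refinc v e.
Proof.
rewrite /bd (bigD1 e) //= eqxx big1 ?addr0 ?mulrzz ?mul1r // => e' /negbTE ->.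
by rewrite mul0rz.
Qed.

(** Reversing an edge negates its incidence numbers, so flows of any orientation become flows of the
    reference orientation after sign changes. *)
Lemma is_flowE A (o : orientation E) (f : E -> A) :
  is_flow src dst o f = flow (fun e => if o e then f e else - f e).
Proof.
apply: eq_forallb => v; congr (_ == _); apply: eq_bigr => e _.
rewrite /inc /is_loop /otail /Defs.ohead /refinc.
case: eqP => [->|]; first by rewrite subrr !mulr0z.
move=> nl; case: (o e); case: (src e =P v) => [s|_]; case: (dst e =P v) => [d|_];
  rewrite ?subrr ?subr0 ?sub0r ?mulr0z ?mulr1z ?mulrN1z ?opprK ?mulNrz ?mulr1z //;
  by case: nl; rewrite s d.
Qed.

(** * Paths and cycles *)

(* [K e d] says that the edge [e] may be traversed from [src] to [dst] if
   [d = true], and from [dst] to [src] if [d = false]. *)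
Definition arc (K : E -> bool -> bool) : rel V := fun x y =>
  [exists e, (K e true && ((src e == x) && (dst e == y))) ||
             (K e false && ((src e == y) && (dst e == x)))].

(** A simple path, taken as a signed edge indicator, is a unit flow from [a] to [b]; simplicity
    keeps the values in {-1, 0, 1}. *)
Lemma arc_connect_bd K a b : connect (arc K) a b ->
  exists x : E -> int,
    (forall e, [\/ x e = 0, x e = 1 /\ K e true | x e = -1 /\ K e false]) /\
    (forall v, bd x v = (a == v)%:R - (b == v)%:R).
Proof.
case/connectP => p0 /shortenP[p + + _ {p0}] ->.
suff: path (arc K) a p -> uniq (a :: p) -> exists x : E -> int,
  [/\ (forall e, [\/ x e = 0, x e = 1 /\ K e true | x e = -1 /\ K e false]),
      (forall e, x e != 0 -> (src e \in a :: p) && (dst e \in a :: p)) &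
    (forall v, bd x v = (a == v)%:R - (last a p == v)%:R)].
  by move=> H pp up; have [x [h1 _ h2]] := H pp up; exists x.
elim: p a => [|c p IH] a /=.
  move=> _ _; exists (fun=> 0); split=> [e|e|v].
  - by constructor 1.
  - by rewrite eqxx.
  - by rewrite subrr /bd big1 // => e _; rewrite mul0rz.
case/andP => /existsP[e he] pp /andP[ncp up].
have [x [xK xs xb]] := IH c pp up.
(* The rest of the path avoids [a], an end of [e]; the support is tracked in the induction for this
   purpose. *)
have xe0 : x e = 0.
  apply/eqP; apply: contraT => /xs /andP[h1 h2].
  case/orP: he => /and3P[_ /eqP ha /eqP hc]; move: h1 h2;
    by rewrite ha hc (negbTE ncp).
case/orP: he => /and3P[Ke /eqP ha /eqP hc].
- exists (fun e' => (e' == e)%:R + x e'); split=> [e'|e'|v].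
  + have [->|ne] := eqVneq e' e; first by rewrite xe0; constructor 2.
    by rewrite add0r; apply: xK.
  + have [-> _|ne] := eqVneq e' e.
      by rewrite !inE ha hc !eqxx orbT.
    by rewrite add0r => /xs; rewrite !inE => /andP[-> ->]; rewrite !orbT.
  + by rewrite bdD bd_delta xb /refinc ha hc addrA subrK.
- exists (fun e' => - (e' == e)%:R + x e'); split=> [e'|e'|v].
  + have [->|ne] := eqVneq e' e; first by rewrite xe0; constructor 3.
    by rewrite oppr0 add0r; apply: xK.
  + have [-> _|ne] := eqVneq e' e.
      by rewrite !inE ha hc !eqxx orbT.
    by rewrite oppr0 add0r => /xs; rewrite !inE => /andP[-> ->]; rewrite !orbT.
  + by rewrite bdD bdN bd_delta xb /refinc ha hc opprB addrA subrK.
Qed.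

Definition linked B e := connect (adj src dst (mem B)) (src e) (dst e).

(** The cycle consists of [e] and a path in [B] from [src e] to [dst e], traversed backwards. *)
Lemma linked_flow B e : e \notin B -> linked B e ->
  exists x : E -> int, [/\ flow x, x e = 1, (forall e', `|x e'| <= 1) &
    forall e', e' \notin e |: B -> x e' = 0].
Proof.
move=> eB; rewrite /linked.
have /eq_connect -> : adj src dst (mem B) =2 arc (fun e' _ => e' \in B).
  by move=> a b; apply: eq_existsb => e'; rewrite -andb_orr.
case/arc_connect_bd => x [xK xb].
have x0 e' : e' \notin B -> x e' = 0.
  by case: (xK e') => [|[_ ->]|[_ ->]].
exists (fun e' => (e' == e)%:R - x e'); split=> [|||e'].
- by apply/flowP => v; rewrite bdD bdN bd_delta xb /refinc subrr.
- by rewrite eqxx x0 // subr0.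
- move=> e'; have [->|_] := eqVneq e' e; first by rewrite x0 ?subr0 ?normr1.
  by rewrite sub0r normrN; case: (xK e') => [->|[-> _]|[-> _]].
- by rewrite !inE negb_or => /andP[/negbTE -> /x0 ->]; rewrite subr0.
Qed.

Lemma sum_bd A (f : E -> A) (S : {set V}) :
  \sum_(v in S) bd f v = \sum_e f e *~ ((src e \in S)%:R - (dst e \in S)%:R).
Proof.
have card1 (u : V) : \sum_(v in S) (u == v)%:R = (u \in S)%:R :> int.
  have [uS|uS] := boolP (u \in S).
    rewrite (bigD1 u) //= eqxx big1 ?addr0 // => v /andP[_ /negbTE].
    by rewrite eq_sym => ->.
  by rewrite big1 // => v vS; case: eqP => // uv; rewrite uv vS in uS.
rewrite exchange_big; apply: eq_bigr => e _.
by rewrite -mulrz_sumr /refinc big_split /= sumrN !card1.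
Qed.

Lemma adj_sym (P : pred E) : connect_sym (adj src dst P).
Proof.
apply: sym_connect_sym => x y; apply: eq_existsb => e.
by rewrite orbC.
Qed.

(** Let [S] be the component of [src e] in [B]. Only [e] can carry flow out of [S], so conservation
    summed over [S] leaves [f e = 0]. *)
Lemma unlinked_flow A B e (f : E -> A) : ~~ linked B e -> flow f ->
  (forall e', e' \notin e |: B -> f e' = 0) -> f e = 0.
Proof.
move=> nl /flowP ff f0.
have [|eB] := boolP (e \in B).
  move=> eB; case/negP: nl; apply: connect1; apply/existsP; exists e.
  by rewrite /= eB !eqxx.
set S := [set v | connect (adj src dst (mem B)) (src e) v].
have := sum_bd f S; rewrite big1 => [|v _]; last exact: ff.
rewrite (bigD1 e) //= big1 => [|e' ne].
  by rewrite addr0 !inE connect0 -/(linked B e) (negbTE nl) subr0 mulr1z.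
have [e'B|e'B] := boolP (e' \in B); last by rewrite f0 ?mul0rz // !inE negb_or ne.
rewrite !inE; have -> : connect (adj src dst (mem B)) (src e) (dst e')
   = connect (adj src dst (mem B)) (src e) (src e').
  rewrite ![connect _ (src e) _]adj_sym; apply: (same_connect (adj_sym _)).
  rewrite adj_sym; apply: connect1; apply/existsP; exists e'.
  by rewrite /= e'B !eqxx.
by rewrite subrr mulr0z.
Qed.

(** * The cyclomatic number *)

(** The two-valued functions constant on components. There are 2^c of them for c components, so
    component numbers can be compared by counting functions. *)
Definition const_on (P : pred E) : {set {ffun V -> bool}} :=
  [set h : {ffun V -> bool} | [forall e, P e ==> (h (src e) == h (dst e))]].

Lemma const_onP P (h : {ffun V -> bool}) x y :
  h \in const_on P -> connect (adj src dst P) x y -> h x = h y.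
Proof.
rewrite inE => /forallP hP /connectP[p + ->] {y}.
elim: p x => //= y p IH x /andP[/existsP[e /andP[Pe he]] /IH <-].
have /eqP := implyP (hP e) Pe.
by case/orP: he => /andP[/eqP -> /eqP ->].
Qed.

Lemma card_const_on P : #|const_on P| = (2 ^ ncomp_sub src dst P)%N.
Proof.
(* [ncomp_sub] takes the components of a relation that is already a closure; closing it again
   changes nothing. *)
set c := connect (connect (adj src dst P)).
have cE : c =2 connect (adj src dst P).
  move=> x y; apply/idP/idP; last exact: connect1.
  by apply: connect_sub.
have csym : connect_sym (connect (adj src dst P)).
  by move=> x y; rewrite -/c !cE adj_sym.
set rt := fingraph.root (connect (adj src dst P)).
pose Rt := [set x | rt x == x].
have -> : ncomp_sub src dst P = #|Rt|.
  by apply: eq_card => x; rewrite !inE andbT.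
rewrite -card_powerset.
pose F (S : {set V}) : {ffun V -> bool} := [ffun x => rt x \in S].
have rtrt x : rt (rt x) = rt x by exact: (root_root csym).
have Finj : {in powerset Rt &, injective F}.
  move=> S S'; rewrite !inE => /subsetP sS /subsetP sS' /ffunP FF.
  apply/setP => x; have := FF x; rewrite !ffunE => h.
  have [hx|hx] := boolP (x \in Rt).
    by move: hx h; rewrite inE => /eqP ->.
  by rewrite (contraNF (sS x) hx) (contraNF (sS' x) hx).
rewrite -(card_in_imset Finj); apply: eq_card => h; apply/idP/imsetP.
  move=> hc; exists [set x in Rt | h x].
    by rewrite inE; apply/subsetP => x; rewrite inE => /andP[].
  apply/ffunP => x; rewrite ffunE !inE rtrt eqxx /=.
  apply: (const_onP hc); rewrite -cE; exact: connect_root.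
case=> S _ ->; rewrite inE; apply/forallP => e; apply/implyP => Pe.
rewrite !ffunE; have -> // : rt (src e) = rt (dst e).
apply/(fingraph.rootP csym); rewrite -/c cE; apply: connect1.
by apply/existsP; exists e; rewrite Pe !eqxx.
Qed.

Lemma eq_const_on P Q : P =1 Q -> const_on P = const_on Q.
Proof. by move=> PQ; apply/setP => h; rewrite !inE; apply: eq_forallb => e; rewrite PQ. Qed.

Local Opaque ncomp_sub.

Lemma exp2n_inj : injective (expn 2).
Proof. by move=> m n /eqP; rewrite eqn_exp2l // => /eqP. Qed.

Lemma ncomp_card_const_on P n :
  #|const_on P| = (2 ^ n)%N -> ncomp_sub src dst P = n.
Proof. by move=> h; apply: exp2n_inj; rewrite -h card_const_on. Qed.

Lemma eq_ncomp_sub P Q : P =1 Q -> ncomp_sub src dst P = ncomp_sub src dst Q.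
Proof.
by move=> PQ; apply: ncomp_card_const_on; rewrite (eq_const_on PQ) card_const_on.
Qed.

Notation ncompS B := (ncomp_sub src dst (mem B)).

Lemma const_on_setU1 B e :
  const_on (mem (e |: B)) = [set h in const_on (mem B) | h (src e) == h (dst e)].
Proof.
apply/setP => h; rewrite !inE; apply/forallP/andP.
  move=> H; split; last by have := H e; rewrite /= !inE eqxx.
  by apply/forallP => e'; apply/implyP => /= e'B; have := H e'; rewrite /= !inE e'B orbT.
case=> /forallP H he e'; apply/implyP; rewrite /= !inE => /orP[/eqP -> //|].
exact: (implyP (H e')).
Qed.

Lemma ncomp_linked B e : linked B e -> ncompS (e |: B) = ncompS B.
Proof.
move=> l; apply: ncomp_card_const_on; rewrite -card_const_on const_on_setU1.
apply: eq_card => h; rewrite !inE; apply/andP/idP => [[]//|hc]; split=> //.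
apply/eqP; apply: (@const_onP (mem B)) l; by rewrite inE.
Qed.

(** Flipping values on the component of [src e] exchanges the functions that agree at the ends of
    [e] with those that disagree, so adding [e] keeps exactly half of them. *)
Lemma ncomp_unlinked B e : ~~ linked B e -> ncompS B = (ncompS (e |: B)).+1.
Proof.
move=> nl; apply: ncomp_card_const_on; rewrite expnS -card_const_on const_on_setU1.
set S := [set v | connect (adj src dst (mem B)) (src e) v].
pose flip (h : {ffun V -> bool}) : {ffun V -> bool} := [ffun v => h v (+) (v \in S)].
have flipK : involutive flip by move=> h; apply/ffunP => v; rewrite !ffunE addbK.
have flipc h : h \in const_on (mem B) -> flip h \in const_on (mem B).
  rewrite !inE => /forallP H; apply/forallP => e'; apply/implyP => e'B.
  rewrite !ffunE (eqP (implyP (H e') e'B)) !inE.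
  have -> // : connect (adj src dst (mem B)) (src e) (dst e')
   = connect (adj src dst (mem B)) (src e) (src e').
  rewrite ![connect _ (src e) _]adj_sym; apply: (same_connect (adj_sym _)).
  rewrite adj_sym; apply: connect1; apply/existsP; exists e'.
  by move: e'B => /= ->; rewrite !eqxx.
rewrite -(cardsID [set h : {ffun V -> bool} | h (src e) == h (dst e)]).
have -> : const_on (mem B) :&: [set h : {ffun V -> bool} | h (src e) == h (dst e)]
  = [set h in const_on (mem B) | h (src e) == h (dst e)].
  by apply/setP => h; rewrite !in_setI !in_set.
rewrite mul2n -addnn; congr (_ + _)%N.
rewrite -(card_imset _ (inv_inj flipK)); apply: eq_card => h.
have fs h' : (flip h' (src e) == flip h' (dst e)) = ~~ (h' (src e) == h' (dst e)).
  rewrite !ffunE !in_set connect0 -/(linked B e) (negbTE nl) addbF addbT.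
  by case: (h' _) (h' _) => [] [].
apply/imsetP/idP.
  case=> h' h'1 ->; move: h'1; rewrite in_setD in_set => /andP[h1 h2].
  by rewrite inE fs h1 flipc.
rewrite inE => /andP[h1 h2]; exists (flip h); last by rewrite flipK.
by rewrite in_setD in_set fs h2 flipc.
Qed.

Definition cyc B : nat := (#|B| + ncompS B - #|V|)%N.

Lemma ncomp_set0 : ncompS (set0 : {set E}) = #|V|.
Proof.
apply: ncomp_card_const_on; rewrite -card_bool -card_ffun -cardsT.
apply: eq_card => h; rewrite !inE; apply/forallP => e.
by rewrite /= inE.
Qed.

(** Shows that the truncated subtraction in [cyc] never truncates. *)
Lemma cycE B : (#|V| + cyc B = #|B| + ncompS B)%N.
Proof.
rewrite /cyc subnKC //; elim/set_ind: B => [|B e eB IH]; first by rewrite cards0 ncomp_set0.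
 rewrite cardsU1 eB; have [l|nl] := boolP (linked B e).
  by rewrite ncomp_linked //; lia.
by move: IH; rewrite (ncomp_unlinked nl); lia.
Qed.

Lemma cyc0 : cyc set0 = 0%N.
Proof. by rewrite /cyc cards0 ncomp_set0 subnn. Qed.

Lemma cyc_linked B e : e \notin B -> linked B e -> cyc (e |: B) = (cyc B).+1.
Proof.
move=> eB l; have := cycE (e |: B); have := cycE B.
by rewrite cardsU1 eB ncomp_linked //; lia.
Qed.

Lemma cyc_unlinked B e : e \notin B -> ~~ linked B e -> cyc (e |: B) = cyc B.
Proof.
move=> eB l; have := cycE (e |: B); have := cycE B.
by rewrite cardsU1 eB (ncomp_unlinked l); lia.
Qed.

Lemma cyc_setT : cyc [set: E] = cyclo src dst.
Proof.
rewrite /cyc /cyclo /ncomp cardsT (@eq_ncomp_sub _ predT) // => e.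
by rewrite /= inE.
Qed.

Lemma bridgelessE e : ~~ is_bridge src dst e -> linked [set~ e] e.
Proof.
apply: contraR => /ncomp_unlinked h; rewrite /is_bridge /ncomp.
have -> : ncomp_sub src dst (predC1 e) = ncompS [set~ e].
  by apply: eq_ncomp_sub => e'; rewrite /= !inE.
rewrite h ltnS; apply: eq_leq.
by apply: eq_ncomp_sub => e'; rewrite /= !inE orbN.
Qed.

(** * Counting group-valued flows *)

Definition vanish A Z (f : E -> A) := [forall e in Z, f e == 0].

Lemma vanishP A Z (f : E -> A) : reflect {in Z, forall e, f e = 0} (vanish Z f).
Proof. by apply: (iffP forall_inP) => h e /h /eqP. Qed.

Lemma vanishU1 A Z e (f : E -> A) : vanish (e |: Z) f = (f e == 0) && vanish Z f.
Proof.
apply/vanishP/andP => [h|[/eqP h1 /vanishP h2] e'].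
  split; first by rewrite h // setU11.
  by apply/vanishP => e' e'Z; rewrite h // setU1r.
by rewrite !inE => /orP[/eqP->|/h2].
Qed.

Lemma setC_setU1 Z e : e \notin Z -> e |: ~: (e |: Z) = ~: Z.
Proof. by move=> eZ; apply/setP => e'; rewrite !inE negb_or; case: eqP => // ->. Qed.

(** All groups are covered at once because the same edge is examined for integer flows and for flows
    modulo q. *)
Definition dead_edge Z e : Prop :=
  forall A (f : E -> A), flow f -> vanish Z f -> f e = 0.

(** The alternative driving the later inductions: whether [e] is linked outside [e |: Z] decides
    both the change of [cyc] and the existence of a cycle through [e]. The bound on [x] is what
    rounding needs. *)
Lemma cyc_setC_dichotomy Z e : e \notin Z ->
  (cyc (~: Z) = (cyc (~: (e |: Z))).+1 /\
   exists x : E -> int, [/\ flow x, vanish Z x, x e = 1 & forall e', `|x e'| <= 1])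
  \/ (cyc (~: Z) = cyc (~: (e |: Z)) /\ dead_edge Z e).
Proof.
move=> eZ; have eB : e \notin ~: (e |: Z) by rewrite !inE eqxx.
have UE := setC_setU1 eZ; rewrite -UE.
have [l|nl] := boolP (linked (~: (e |: Z)) e); [left|right]; split.
- exact: cyc_linked.
- have [x [fx xe x1 x0]] := linked_flow eB l; exists x; split=> //.
  by apply/vanishP => e' e'Z; apply: x0; rewrite UE inE negbK.
- exact: cyc_unlinked.
- move=> A f ff /vanishP f0; apply: unlinked_flow nl ff _ => e'.
  by rewrite UE inE negbK; apply: f0.
Qed.

Lemma setC_ind (P : {set E} -> Prop) :
  P setT -> (forall Z e, e \notin Z -> P (e |: Z) -> P Z) -> forall Z, P Z.
Proof.
move=> PT PU Z; rewrite -(setCK Z); elim/set_ind: (~: Z); first by rewrite setC0.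
move=> B e eB PB; apply: (PU _ e); first by rewrite !inE eqxx.
by rewrite [_ |: _](_ : _ = ~: B) //; apply/setP => e'; rewrite !inE; case: eqP => // ->.
Qed.

(** If a cycle [x] through [e] exists, a flow vanishing on [Z] is uniquely a multiple of [x] plus a
    flow vanishing on [e |: Z], which gives a factor [#|A|]; a dead edge changes nothing. *)
Lemma card_flows (A : finZmodType) Z :
  #|[set f : {ffun E -> A} | flow f & vanish Z f]| = (#|A| ^ cyc (~: Z))%N.
Proof.
elim/setC_ind: Z => [|Z e eZ IH].
  rewrite setCT cyc0 expn0 -(cards1 ([ffun=> 0] : {ffun E -> A})).
  apply: eq_card => f; rewrite !inE; apply/andP/eqP => [[_ /vanishP f0]|->].
    by apply/ffunP => e; rewrite ffunE f0.
  split; last by apply/vanishP => e _; rewrite ffunE.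
  by rewrite (eq_flow (g := fun=> 0)) ?flow0 // => e; rewrite ffunE.
have [[-> [x [fx /vanishP x0 xe _]]]|[-> h]] := cyc_setC_dichotomy eZ; last first.
  rewrite -IH; apply: eq_card => f; rewrite !inE vanishU1.
  by apply/andP/andP => -[ff]; [move=> fv; rewrite (h _ _ ff fv) eqxx | case/andP].
rewrite expnS -IH.
pose F (p : A * {ffun E -> A}) : {ffun E -> A} := [ffun e' => p.2 e' + p.1 *~ x e'].
have Finj : {in setX [set: A] [set f : {ffun E -> A} | flow f & vanish (e |: Z) f] &,
    injective F}.
  move=> [a f] [b g]; rewrite !inE !vanishU1 /= => /and3P[_ /eqP fe _] /and3P[_ /eqP ge _] /ffunP FF.
  have ab : a = b by have := FF e; rewrite !ffunE /= fe ge xe !add0r !mulr1z.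
  congr (_, _) => //; apply/ffunP => e'; have := FF e'; rewrite !ffunE /= ab.
  exact: addIr.
rewrite [RHS](_ : _ = #|setX [set: A] [set f : {ffun E -> A} | flow f & vanish (e |: Z) f]|).
  rewrite -(card_in_imset Finj); apply: eq_card => f; rewrite inE; apply/andP/imsetP.
    case=> ff /vanishP f0; exists (f e, [ffun e' => f e' - f e *~ x e']).
      rewrite !inE vanishU1 ffunE xe mulr1z subrr eqxx /=; apply/andP; split.
        rewrite (eq_flow (g := fun e' => f e' - f e *~ x e')) => [|e']; last by rewrite ffunE.
        exact: flowB ff (flow_mulrz _ fx).
      by apply/vanishP => e' e'Z; rewrite ffunE f0 ?x0 // mulr0z subr0.
    by apply/ffunP => e'; rewrite !ffunE /= subrK.
  case=> -[a g]; rewrite !inE vanishU1 /= => /and3P[gf _ /vanishP g0] ->; split.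
    rewrite (eq_flow (g := fun e' => g e' + a *~ x e')) => [|e']; last by rewrite ffunE.
    exact: flowD gf (flow_mulrz _ fx).
  by apply/vanishP => e' e'Z; rewrite ffunE /= g0 ?x0 // mulr0z addr0.
by rewrite !cardsX cardsT.
Qed.

(** * Integer flows *)

Lemma intr_Zp_eq0 m (n : int) : (n%:~R == 0 :> 'I_m.+2) = (m.+2 %| n)%Z.
Proof.
have nat_eq0 k : (k%:R == 0 :> 'I_m.+2) = (m.+2 %| k)%N.
  by rewrite Zp_nat -val_eqE /= /dvdn.
case: n => n; first by rewrite -pmulrn nat_eq0 dvdzE.
by rewrite NegzE mulrNz oppr_eq0 -pmulrn nat_eq0 dvdzE.
Qed.

(* Rounding: move along cycles of edges whose value is not a multiple of [q]; in one of
   the two directions the concave potential [\sum_e r (q - r)], with [r] the residue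
   of [h e], decreases. *)
Lemma flow_rounding (q : int) (h : E -> int) : 0 < q -> flow h ->
  exists2 w : E -> int, flow w & forall e, `|h e - q * w e| < q.
Proof.
move=> q0.
pose pot (h : E -> int) := \sum_e (h e %% q)%Z * (q - (h e %% q)%Z).
have modq z : 0 <= (z %% q)%Z < q.
  by rewrite modz_ge0 ?gt_eqF //= ltz_pmod.
have pot0 h' : 0 <= pot h'.
  by apply: sumr_ge0 => e _; have := modq (h' e); nia.
elim: {h}(absz (pot h)).+1 {-2}h (ltnSn (absz (pot h))) => // n IH h ltn fh.
have [hq|] := boolP [forall e, (q %| h e)%Z].
  exists (fun e => (h e %/ q)%Z).
    apply: (@flow_div q); first by rewrite gt_eqF.
    rewrite (eq_flow (g := h)) // => e.
    by rewrite mulrC divzK //; apply: (forallP hq).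
  by move=> e; rewrite [q * _]mulrC divzK ?subrr ?normr0 //; apply: (forallP hq).
rewrite negb_forall => /existsP[e0 he0].
pose Z := [set e | (q %| h e)%Z].
have e0Z : e0 \notin Z by rewrite inE.
have [[_ [x [fx /vanishP x0 xe x1]]]|[_ bad]] := cyc_setC_dichotomy e0Z; last first.
  (* If [e0] were dead, the reduction of [h] modulo [q], which vanishes on [Z], would vanish at [e0]
     too. The case [q = 1] is excluded since 1 divides every value. *)
  have [m qE] : exists m, q = Posz m.+2.
    have : q != 1 by apply: contraNneq he0 => ->; rewrite dvd1z.
    by exists (absz q).-2; lia.
  case/negP: he0; rewrite qE -intr_Zp_eq0.
  apply/eqP; apply: (bad 'I_m.+2 (fun e => (h e)%:~R)); first exact: flow_mulrz.
  by apply/vanishP => e; rewrite inE qE -intr_Zp_eq0 => /eqP.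
(* Off [Z] the residue lies strictly between 0 and [q], so a unit step does not cross a multiple of
   [q]. *)
have xr (s : int) e : `|s| = 1 -> 0 <= (h e %% q)%Z + s * x e <= q.
  move=> s1; have [eZ|eZ] := boolP (e \in Z).
    by rewrite x0 // mulr0 addr0; have := modq (h e); lia.
  have : (h e %% q)%Z != 0 by apply: contraNneq eZ => h0; rewrite inE; apply/dvdz_mod0P.
  have := modq (h e); have := x1 e; have : s = 1 \/ s = -1 by lia.
  by case=> ->; lia.
pose a := \sum_e x e * (q - (h e %% q)%Z *+ 2).
pose b := \sum_e x e * x e.
have potE (s : int) : `|s| = 1 -> pot (fun e => h e + s * x e) = pot h + s * a - b.
  move=> s1; rewrite mulr_sumr -sumrN -!big_split; apply: eq_bigr => e _ /=.
  rewrite -modzDml.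
  have /andP[r0 rq] := xr s e s1; set r := (h e %% q)%Z in r0 rq *.
  have ss : s * s = 1.
    by have [->|->] : s = 1 \/ s = -1 by lia.
  have -> : ((r + s * x e) %% q)%Z * (q - ((r + s * x e) %% q)%Z)
      = (r + s * x e) * (q - (r + s * x e)).
    move: rq; rewrite le_eqVlt => /orP[/eqP ->|rq]; first by rewrite modzz subrr mulr0 mul0r.
    by rewrite modz_small // r0.
  transitivity (r * (q - r) + s * (x e * (q - r *+ 2)) - (s * s) * (x e * x e)).
    by ring.
  by rewrite ss mul1r.
have b0 : 0 < b.
  by rewrite /b (bigD1 e0) //= xe mulr1 ltr_wpDr // sumr_ge0 // => e _; rewrite -expr2 sqr_ge0.
(* The linear terms for [s = 1] and [s = -1] are opposite and [- b] is negative, so one of the two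
   signs lowers the potential. *)
have [s [s1 ltpot]] : exists s : int, `|s| = 1 /\ pot (fun e => h e + s * x e) < pot h.
  have [a0|a0] := leP a 0; [exists 1 | exists (-1)]; split=> //;
    rewrite potE // -addrA gtrDl ?mul1r ?mulN1r subr_lt0.
    exact: le_lt_trans a0 b0.
  by apply: lt_trans b0; rewrite oppr_lt0.
have [] := IH (fun e => h e + s * x e).
- have := pot0 h; have := pot0 (fun e => h e + s * x e); lia.
- exact: flowD fh (flowMl _ fx).
move=> w fw wq; exists w => // e; have := wq e.
have [eZ|eZ] := boolP (e \in Z); first by rewrite x0 // mulr0 addr0.
have hr : (h e %% q)%Z != 0 by apply: contraNneq eZ => h0; rewrite inE; apply/dvdz_mod0P.
move: (xr s e s1) (modq (h e)) hr (divz_eq (h e) q).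
move: (w e) (h e) (s * x e) (h e %/ q)%Z (h e %% q)%Z => t z y m r hy hr r0 -> ht.
(* Before and after the step the value lies between m q and (m + 1) q, so the bound after the step
   forces [t] to be m or m + 1. The original value is strictly inside, hence within [q] of either
   end. *)
have [k mk] : exists k : int, m = t + k by exists (m - t); lia.
move: ht; rewrite mk => ht.
have [k0|k0] : k = 0 \/ k = -1 by nia.
all: by rewrite k0; nia.
Qed.

(** Lifting edge by edge along integer cycles gives some integer flow over [g]; subtracting [m.+2]
    times its rounding makes it small. *)
Lemma flow_lift m (g : E -> 'I_m.+2) : flow g ->
  exists h : E -> int, [/\ flow h, forall e, (h e)%:~R = g e & forall e, `|h e| < m.+2].
Proof.
move=> fg.
have [h fh hg] : exists2 h : E -> int, flow h & forall e, (h e)%:~R = g e.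
  have : vanish set0 g by apply/vanishP => e; rewrite inE.
  elim/setC_ind: set0 g fg => [|Z e eZ IH] g fg.
    move/vanishP => g0; exists (fun=> 0) => [|e]; first exact: flow0.
    by rewrite g0.
  move=> gZ; have [[_ [x [fx /vanishP x0 xe _]]]|[_ bad]] := cyc_setC_dichotomy eZ; last first.
    by apply: IH (fg) _; rewrite vanishU1 gZ (bad _ _ fg gZ) eqxx.
  have [||h fh hg] := IH (fun e' => g e' - g e *~ x e').
  - exact: flowB fg (flow_mulrz _ fx).
  - rewrite vanishU1 xe mulr1z subrr eqxx /=; apply/vanishP => e' e'Z.
    by rewrite x0 // (vanishP _ _ gZ) // mulr0z subrr.
  exists (fun e' => h e' + (g e)%:Z * x e') => [|e']; first exact: flowD fh (flowMl _ fx).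
  by rewrite intrD hg mulrzA -pmulrn natr_Zp subrK.
have [//|w fw hw] := @flow_rounding m.+2 h _ fh.
exists (fun e => h e - m.+2%:Z * w e); split=> // [|e].
  exact: flowB fh (flowMl _ fw).
have /eqP q0 : (m.+2%:Z)%:~R == 0 :> 'I_m.+2 by rewrite intr_Zp_eq0.
by rewrite rmorphB rmorphM /= q0 mul0r subr0.
Qed.

(** * Orientations *)

Implicit Types o rho : orientation E.

(** In reference coordinates, strict positivity along the directions of [o]. Total cyclicity amounts
    to the existence of a flow with this property. *)
Definition signs o (z : E -> int) := forall e, if o e then 0 < z e else z e < 0.

(** Across a directed cut all terms of the net flow would have the same strict sign, yet they sum to
    zero. *)
Lemma signs_totally_cyclic o z : flow z -> signs o z -> totally_cyclic src dst o.
Proof.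
move=> /flowP fz sz; apply/existsPn => S; apply/negP => /andP[/and3P[_ _ /existsP[e0 ce0]]].
have := sum_bd z S; rewrite big1 // => /esym/eqP.
have termE e : crossing src dst S e -> (z e *~ ((src e \in S)%:R - (dst e \in S)%:R)) =
    (if otail src dst o e \in S then `|z e| else - `|z e|).
  rewrite /crossing /otail; have := sz e.
  case: (o e) => ze; case: (src e \in S); case: (dst e \in S) => // _;
  by rewrite mulrzz ?subr0 ?sub0r ?mulr1 ?mulrN1 ?(gtr0_norm ze) ?(ltr0_norm ze) ?opprK.
have term0 e : ~~ crossing src dst S e -> (z e *~ ((src e \in S)%:R - (dst e \in S)%:R)) = 0.
  by rewrite negbK => /eqP ->; rewrite subrr mulr0z.
have nz : 0 < `|z e0| by have := sz e0; rewrite normr_gt0; case: (o e0) => [/gt_eqF|/lt_eqF] ->.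
move=> sum0 /orP[] /forallP h.
- have : 0 < \sum_e z e *~ ((src e \in S)%:R - (dst e \in S)%:R); last by rewrite (eqP sum0).
  rewrite (bigD1 e0) //= termE // (implyP (h e0)) // ltr_wpDr // sumr_ge0 // => e _.
  have [ce|/term0 ->//] := boolP (crossing src dst S e).
  by rewrite termE // (implyP (h e)).
- have tl e : crossing src dst S e -> (otail src dst o e \in S) = false.
    move=> ce; have := implyP (h e) ce; move: ce; rewrite /crossing /otail /Defs.ohead.
    by case: (o e); case: (src e \in S); case: (dst e \in S).
  have : 0 < - \sum_e z e *~ ((src e \in S)%:R - (dst e \in S)%:R); last by rewrite (eqP sum0).
  rewrite -sumrN (bigD1 e0) //= termE // tl // opprK ltr_wpDr // sumr_ge0 // => e _.
  have [ce|/term0 ->] := boolP (crossing src dst S e); last by rewrite oppr0.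
  by rewrite termE // tl // opprK.
Qed.

(** Every edge lies on a directed closed walk, since otherwise the vertices reachable from its head
    would form a directed cut. Summing one nonnegative flow per edge gives positivity everywhere. *)
Lemma totally_cyclic_signs o : totally_cyclic src dst o ->
  exists2 z : E -> int, flow z & signs o z.
Proof.
move=> tc.
have cyc_e e : exists x : E -> int, [/\ flow x,
    (forall e', if o e' then 0 <= x e' else x e' <= 0) &
    if o e then 0 < x e else x e < 0].
  pose K e' d := o e' == d.
  have headS v : (Defs.ohead src dst o e == v)%:R - (otail src dst o e == v)%:R
      = - (if o e then refinc v e else - refinc v e).
    by rewrite /Defs.ohead /otail /refinc; case: (o e); rewrite ?opprK ?opprB.
  have [|nc] := boolP (connect (arc K) (Defs.ohead src dst o e) (otail src dst o e)).
    case/arc_connect_bd => x [xK xb].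
    have xs e' : if o e' then 0 <= x e' else x e' <= 0.
      by case: (xK e') => [->|[-> /eqP ->]|[-> /eqP ->]] //; case: (o e').
    exists (fun e' => x e' + (if o e then (e' == e)%:R else - (e' == e)%:R)); split=> [|e'|].
    - apply/flowP => v; rewrite bdD xb headS.
      by case: (o e); rewrite ?bdN bd_delta addNr.
    - have := xs e'; have [->|_] := eqVneq e' e; last by case: (o e); rewrite ?oppr0 addr0.
      by case: (o e); lia.
    - by have := xs e; rewrite eqxx; case: (o e); lia.
  case/existsP: tc; pose S := [set v | connect (arc K) (Defs.ohead src dst o e) v].
  exists S; apply/andP; split.
    have hS : Defs.ohead src dst o e \in S by rewrite inE connect0.
    have tS : otail src dst o e \notin S by rewrite inE.
    apply/and3P; split.
    - by apply/set0Pn; exists (Defs.ohead src dst o e).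
    - by apply: contraNneq tS => ->; rewrite inE.
    - apply/existsP; exists e; move: hS tS; rewrite /crossing /Defs.ohead /otail.
      by case: (o e); case: (src e \in S); case: (dst e \in S).
  apply/orP; right; apply/forallP => e'; apply/implyP => ce.
  apply: contraT => hS; have tS : otail src dst o e' \in S.
    move: hS ce; rewrite /crossing /Defs.ohead /otail.
    by case: (o e'); case: (src e' \in S); case: (dst e' \in S).
  case/negP: hS; move: tS; rewrite !inE => /connect_trans; apply; apply: connect1.
  by apply/existsP; exists e'; rewrite /K /otail /Defs.ohead; case: (o e'); rewrite !eqxx ?orbT.
have [x hx] := fin_all_exists cyc_e.
exists (fun e => \sum_i x i e); first by apply: flow_sum => i; have [] := hx i.
move=> e; have xie i : if o e then 0 <= x i e else x i e <= 0 by have [_ + _] := hx i; apply.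
have [_ _ xe] := hx e; move: xie xe; rewrite (bigD1 e) //=; case: (o e) => xie xe.
  by rewrite ltr_wpDr // sumr_ge0 // => i _; apply: xie.
by rewrite -oppr_gt0 opprD -sumrN ltr_wpDr ?oppr_gt0 // sumr_ge0 // => i _; rewrite oppr_ge0.
Qed.

(** The difference is 1 or -1, according to the direction in [o1], on the edges where the
    orientations differ, and 0 elsewhere. Equivalence thus becomes additive. *)
Lemma eul_equivE o1 o2 :
  eul_equiv src dst o1 o2 = flow (fun e => (o1 e)%:R - (o2 e)%:R : int).
Proof.
apply: eq_forallb => v.
have cardE (P : pred E) : #|[set e | P e]|%:R = \sum_e (P e)%:R :> int.
  by rewrite -sum1_card natr_sum big_mkcond; apply: eq_bigr => e _; rewrite inE; case: (P e).
rewrite -(eqr_nat int) !cardE -[LHS]subr_eq0 -sumrB; congr (_ == 0); apply: eq_bigr => e _.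
rewrite /otail /Defs.ohead /refinc mulrzz.
by case: (o1 e); case: (o2 e); rewrite /= ?subrr ?mul0r // ?subr0 ?mul1r // sub0r mulN1r opprB.
Qed.

Lemma eul_equiv_refl o : eul_equiv src dst o o.
Proof. by rewrite eul_equivE (eq_flow (g := fun=> 0)) ?flow0 // => e; rewrite subrr. Qed.

Lemma eul_equiv_sym o1 o2 : eul_equiv src dst o1 o2 = eul_equiv src dst o2 o1.
Proof.
by rewrite !eul_equivE; apply/idP/idP => /flowN; apply: etrans; apply: eq_flow => e; rewrite opprB.
Qed.

Lemma eul_equiv_trans o2 o1 o3 : eul_equiv src dst o1 o2 ->
  eul_equiv src dst o2 o3 -> eul_equiv src dst o1 o3.
Proof.
rewrite !eul_equivE => f12 /(flowD f12).
by rewrite (eq_flow (g := fun e => (o1 e)%:R - (o3 e)%:R)) // => e; rewrite addrA subrK.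
Qed.

(** * Counting sign patterns of integer flows *)

Definition realizable D Z (J : {set E}) : Prop := exists x : E -> int,
  [/\ flow x, vanish Z x & {in D, forall e, if e \in J then 0 < x e else x e < 0}].

(** Counts the regions cut out by the coordinate hyperplanes of [D] in the space of flows vanishing
    on [Z]; a region is named by its set [J] of positive coordinates. *)
Definition nsigns D Z : nat := (\sum_(J : {set E} | J \subset D) `[< realizable D Z J >])%N.

Lemma flow_bound (y : E -> int) : exists2 K : int, 0 < K & forall e, `|y e| < K.
Proof.
exists (1 + \sum_e `|y e|) => [|e]; first by rewrite ltr_wpDr // sumr_ge0.
rewrite (bigD1 e) //= addrCA ltrDl ltr_wpDr // sumr_ge0 //.
Qed.

(** Deletion-restriction: a pattern on [D] extends to [e] in at least one way, and in both ways
    exactly when it is realized by a flow vanishing at [e]. If [e] is dead, no strict sign is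
    possible there. *)
Lemma nsignsU1 D Z e : e \notin D -> e \notin Z ->
  nsigns (e |: D) Z =
  if `[< exists x : E -> int, [/\ flow x, vanish Z x & x e = 1] >]
  then (nsigns D Z + nsigns D (e |: Z))%N else 0%N.
Proof.
move=> eD eZ; rewrite /nsigns big_subsetU1 // -!big_split /=.
have inD e' : e' \in D -> e' != e by apply: contraTneq => ->.
have [good|bad] := asboolP; last first.
  have no J : ~ realizable (e |: D) Z J.
    case=> x [fx xZ xs]; have := xs e (setU11 _ _).
    have [[_ [y [fy yZ ye _]]]|[_ h]] := cyc_setC_dichotomy eZ; first by case: bad; exists y.
    by rewrite (h _ _ fx xZ) ltxx; case: ifP.
  by apply: big1 => J _; rewrite !asboolF //; apply: no.
apply: eq_bigr => J JD.
pose core (x : E -> int) := [/\ flow x, vanish Z x &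
  {in D, forall e', if e' \in J then 0 < x e' else x e' < 0}].
have eJ : e \notin J by apply: contra eD => /(subsetP JD).
have negE : realizable (e |: D) Z J <-> exists2 x, core x & x e < 0.
  split=> [[x [fx xZ xs]]|[x [fx xZ xs] xe]].
    exists x; last by have := xs e (setU11 _ _); rewrite (negbTE eJ).
    by split=> // e' e'D; apply: xs; rewrite setU1r.
  exists x; split=> // e'; rewrite !inE => /orP[/eqP ->|/xs//].
  by rewrite (negbTE eJ).
have posE : realizable (e |: D) Z (e |: J) <-> exists2 x, core x & 0 < x e.
  split=> [[x [fx xZ xs]]|[x [fx xZ xs] xe]].
    exists x; last by have := xs e (setU11 _ _); rewrite setU11.
    split=> // e' e'D; have := xs e'; rewrite !inE (negbTE (inD _ e'D)) /=; exact.
  exists x; split=> // e'; rewrite !inE => /orP[/eqP ->|e'D]; first by rewrite eqxx.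
  by rewrite (negbTE (inD _ e'D)) /=; apply: xs.
have zeroE : realizable D (e |: Z) J <-> exists2 x, core x & x e = 0.
  split=> [[x [fx]]|[x [fx xZ xs] xe]].
    by rewrite vanishU1 => /andP[/eqP xe xZ] xs; exists x.
  by exists x; split; rewrite // vanishU1 xe eqxx.
have [y [fy yZ ye]] := good.
(* Scaling [x] by a [K] larger than every entry of [s * y] preserves the signs on [D], while the
   value at [e] becomes [s]. *)
have pert x (s : int) : core x -> x e = 0 -> exists2 x', core x' & x' e = s.
  move=> [fx xZ xs] xe; have [K K0 yK] := flow_bound (fun e' => s * y e').
  exists (fun e' => K * x e' + s * y e'); last by rewrite xe mulr0 add0r ye mulr1.
  split.
  - exact: flowD (flowMl _ fx) (flowMl _ fy).
  - by apply/vanishP => e' e'Z; rewrite (vanishP _ _ xZ e') // (vanishP _ _ yZ e') // !mulr0 addr0.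
  - move=> e' /xs; have := yK e'; move: (s * y e') (x e') => a b; case: ifP => _; nia.
(* A positive combination of two flows with the same signs on [D], weighted to cancel at [e]. *)
have conv x1 x2 : core x1 -> core x2 -> x1 e < 0 -> 0 < x2 e -> exists2 x, core x & x e = 0.
  move=> [f1 Z1 s1] [f2 Z2 s2] n1 p2.
  exists (fun e' => x2 e * x1 e' + - x1 e * x2 e'); last by rewrite mulNr mulrC subrr.
  split.
  - exact: flowD (flowMl _ f1) (flowMl _ f2).
  - by apply/vanishP => e' e'Z; rewrite (vanishP _ _ Z1 e') // (vanishP _ _ Z2 e') // !mulr0 addr0.
  - move=> e' e'D; have := s1 e' e'D; have := s2 e' e'D.
    case: ifP => _ h2 h1.
      by apply: addr_gt0; rewrite mulr_gt0 // oppr_gt0.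
    by rewrite -oppr_gt0 opprD -!mulrN addr_gt0 // mulr_gt0 ?oppr_gt0.
have N0 : realizable D (e |: Z) J -> realizable (e |: D) Z J.
  by move/zeroE => [x cx /(pert _ (-1) cx)[x' cx' x'e]]; apply/negE; exists x'; rewrite ?x'e.
have P0 : realizable D (e |: Z) J -> realizable (e |: D) Z (e |: J).
  by move/zeroE => [x cx /(pert _ 1 cx)[x' cx' x'e]]; apply/posE; exists x'; rewrite ?x'e.
have NP : realizable (e |: D) Z J -> realizable (e |: D) Z (e |: J) ->
    realizable D (e |: Z) J.
  by move/negE => [x1 c1 n1] /posE[x2 c2 p2]; apply/zeroE; apply: (conv x1 x2).
have NX : realizable (e |: D) Z J -> realizable D Z J by move/negE => [x cx _]; exists x.
have PX : realizable (e |: D) Z (e |: J) -> realizable D Z J by move/posE => [x cx _]; exists x.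
have X : realizable D Z J -> ~ realizable (e |: D) Z J -> realizable (e |: D) Z (e |: J).
  move=> [x cx] nN; have [xe|xe|xe] := ltgtP (x e) 0.
  - by case: nN; apply/negE; exists x.
  - by apply/posE; exists x.
  - by apply: P0; apply/zeroE; exists x.
by do 4!case: asboolP => //; tauto.
Qed.

(** The exponent is a sum rather than a difference since only its parity matters. Splitting the
    subsets at [e] reproduces [nsignsU1]; for a dead [e] the terms of [A] and [e |: A] cancel. *)
Lemma nsignsE (R : pzRingType) D Z : {in D, forall e, e \notin Z} ->
  (nsigns D Z)%:R = \sum_(A : {set E} | A \subset D)
     (-1) ^+ (#|A| + cyc (~: Z) + cyc (~: (Z :|: A))) :> R.
Proof.
elim/set_ind: D Z => [|D e eD IH] Z.
  move=> _; have pred0 : (fun J : {set E} => J \subset set0) =1 pred1 set0.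
    by move=> J; rewrite subset0.
  rewrite /nsigns !(big_pred1 set0) // cards0 setU0 add0n addnn -signr_odd odd_double.
  rewrite asboolT //; exists (fun=> 0); split; first exact: flow0.
    by apply/vanishP.
  by move=> e; rewrite inE.
move=> DZ; have eZ : e \notin Z by rewrite DZ // setU11.
have {}DZ : {in D, forall e', e' \notin Z} by move=> e' e'D; rewrite DZ // setU1r.
rewrite nsignsU1 // big_subsetU1 //=.
have eA (A : {set E}) : A \subset D -> e \notin A by move=> AD; apply: contra eD => /(subsetP AD).
have UA (A : {set E}) : Z :|: (e |: A) = (e |: Z) :|: A by rewrite setUCA setUA.
have [[cE [x [fx xZ xe _]]]|[cE bad]] := cyc_setC_dichotomy eZ.
  rewrite asboolT; last by exists x.
  have DeZ : {in D, forall e', e' \notin e |: Z}.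
    by move=> e' e'D; rewrite !inE negb_or DZ // andbT; apply: contraTneq e'D => ->.
  rewrite natrD (IH _ DZ) (IH _ DeZ).
  apply: (congr1 (fun z => _ + z)); apply: eq_bigr => A AD.
  rewrite cardsU1 (eA A AD) UA [in RHS]cE; move: #|A| (cyc (~: (e |: Z))) (cyc _) => i j k.
  by rewrite add1n addnS !addSn !exprS !mulN1r opprK.
clear IH; rewrite asboolF => [|[x [fx xZ xe]]]; last first.
  by have := bad _ _ fx xZ; rewrite xe.
rewrite -big_split; apply/esym/big1 => A AD /=.
have eZA : e \notin Z :|: A by rewrite inE negb_or eZ (eA A AD).
(* An edge dead for [Z] stays dead for the larger set [Z :|: A]. *)
have -> : cyc (~: (Z :|: A)) = cyc (~: (Z :|: (e |: A))).
  rewrite [Z :|: (e |: A)]setUCA.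
  case: (cyc_setC_dichotomy eZA) => [[_ [x [fx xZA xe _]]]|[h _]]; last exact: h.
  exfalso.
  have xZ : vanish Z x.
    by apply/vanishP => e' e'Z; apply: (vanishP _ _ xZA); rewrite inE e'Z.
  by have := bad _ _ fx xZ; rewrite xe.
rewrite cardsU1 (eA A AD); move: #|A| (cyc (~: Z)) (cyc _) => i j k.
by rewrite add1n !addSn exprS mulN1r subrr.
Qed.

(** * Polynomiality of the counts for a fixed orientation *)

Lemma eq_is_flow A o (f g : E -> A) : f =1 g -> is_flow src dst o f = is_flow src dst o g.
Proof. by move=> fg; rewrite !is_flowE; apply: eq_flow => e; rewrite fg. Qed.

Lemma is_flowD A o (f g : E -> A) : is_flow src dst o f -> is_flow src dst o g ->
  is_flow src dst o (fun e => f e + g e).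
Proof.
rewrite !is_flowE => hf /(flowD hf); apply: etrans; apply: eq_flow => e.
by case: (o e); rewrite ?opprD.
Qed.

Lemma is_flowN A o (f : E -> A) : is_flow src dst o f -> is_flow src dst o (fun e => - f e).
Proof.
by rewrite !is_flowE => /flowN; apply: etrans; apply: eq_flow => e; case: (o e).
Qed.

Definition box_flows o q : {set {ffun E -> 'I_q.+1}} :=
  [set f : {ffun E -> 'I_q.+1} | is_flow src dst o (fun e => (f e : nat)%:Z)].

(** The pair [(e, b)] names a bounding hyperplane of the box, the upper one if [b] holds and the
    lower one otherwise; a set of pairs cuts out a face of the flow polytope. *)
Definition tight q (f : {ffun E -> 'I_q.+1}) (c : E * bool) : bool :=
  f c.1 == (if c.2 then q else 0%N) :> nat.

Definition ntight o (T : {set E * bool}) q : nat :=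
  #|[set f in box_flows o q | [forall c in T, tight f c]]|.

Definition binary_flow o (T : {set E * bool}) (w : {ffun E -> bool}) : bool :=
  is_flow src dst o (fun e => (w e)%:Z) && [forall c in T, w c.1 == c.2].

(* Integrality of the faces of the flow polytope. *)
Lemma tight_binary_flow o (T : {set E * bool}) q f : f \in box_flows o q.+1 ->
  [forall c in T, tight f c] -> exists w, binary_flow o T w.
Proof.
rewrite inE is_flowE => ff /forall_inP fT.
have [//|w fw hw] := @flow_rounding q.+1 _ _ ff.
have fq e : (f e <= q.+1)%N by rewrite -ltnS.
pose s e := if o e then w e else - w e.
(* As [f e] is between 0 and [q.+1], an error below [q.+1] leaves only the roundings 0 and 1 along
   [o]. *)
have s01 e : s e = 0 \/ s e = 1.
  have /= := hw e; have := fq e; rewrite /s; move: (f e : nat) (w e) => a b aq.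
  by case: (o e) => h; [have : -1 < b < 2 by nia | have : -2 < b < 1 by nia]; lia.
exists [ffun e => s e == 1]; apply/andP; split.
  rewrite is_flowE (eq_flow (g := w)) // => e; rewrite ffunE.
  by have := s01 e; rewrite /s; case: (o e) => -[] h; lia.
(* The error bound is strict, so entries equal to 0 or [q.+1] are rounded exactly. *)
apply/forall_inP => -[e b] /fT; rewrite /tight /= ffunE => /eqP fe.
have /= := hw e; have := s01 e; rewrite /s fe; case: (o e); case: (b) => -[] h; nia.
Qed.

(* Only the constraints missing [w] prevent [f - w] from lying in the next smaller box. *)
Lemma ntight_shift o (T : {set E * bool}) w q : binary_flow o T w ->
  #|[set f in [set f in box_flows o q.+1 | [forall c in T, tight f c]] |
      [forall c in [set c : E * bool | c.2 == ~~ w c.1], ~~ tight f c]]| = ntight o T q.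
Proof.
case/andP=> fw /forall_inP wT.
pose F (f : {ffun E -> 'I_q.+1}) : {ffun E -> 'I_q.+2} := [ffun e => inord (f e + w e)%N].
have FE f e : F f e = (f e + w e)%N :> nat.
  by rewrite ffunE inordK //; have := ltn_ord (f e); case: (w e); lia.
have Finj : injective F.
  move=> f g /ffunP FF; apply/ffunP => e; apply: val_inj => /=.
  by have := congr1 val (FF e); rewrite /= !FE; lia.
rewrite /ntight -(card_imset _ Finj); apply: eq_card => g; rewrite !inE.
apply/andP/imsetP.
  case=> /andP[fg /forall_inP gT] /forall_inP gw.
  have gwe e : (w e <= g e <= q + w e)%N.
    have := gw (e, ~~ w e); rewrite inE /tight /= eqxx => /(_ isT).
    by have := ltn_ord (g e); case: (w e) => /=; lia.
  pose f : {ffun E -> 'I_q.+1} := [ffun e => inord (g e - w e)%N].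
  have fE e : f e = (g e - w e)%N :> nat.
    by rewrite ffunE inordK //; have := gwe e; case: (w e); lia.
  exists f; last first.
    by apply/ffunP => e; apply: val_inj; rewrite /= FE fE subnK //; case/andP: (gwe e).
  rewrite !inE; apply/andP; split.
    rewrite (eq_is_flow o (g := fun e => (g e : nat)%:Z + - (w e)%:Z)) => [|e].
      exact: is_flowD fg (is_flowN fw).
    by rewrite fE; have := gwe e; case: (w e); lia.
  apply/forall_inP => -[e b] cT; have := gT _ cT; have := wT _ cT.
  by rewrite /tight /= fE => /eqP ->; case: b {cT} => /eqP ->; lia.
case=> f; rewrite !inE => /andP[ff /forall_inP fT] ->; split; first (apply/andP; split).
- rewrite (eq_is_flow o (g := fun e => (f e : nat)%:Z + (w e)%:Z)) => [|e]; last by rewrite FE.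
  exact: is_flowD.
- apply/forall_inP => -[e b] cT; have := fT _ cT; have := wT _ cT.
  by rewrite /tight /= FE => /eqP ->; case: b {cT} => /eqP ->; lia.
- apply/forall_inP => -[e b]; rewrite inE /tight /= FE => /eqP ->.
  by have := ltn_ord (f e); case: (w e) => /=; lia.
Qed.

(** At [q = 0] every constraint is tight at the only point, so even an empty face counts 1 there.
    Hence the claim at 0 is restricted to faces containing a 0-1 flow. *)
Lemma ntight_poly o (T : {set E * bool}) :
  (exists P : {poly rat}, forall q, (ntight o T q.+1)%:R = P.[q.+1%:R]) /\
  ((exists w, binary_flow o T w) ->
   exists P : {poly rat}, forall q, (ntight o T q)%:R = P.[q%:R]).
Proof.
elim: {T}_.+1 {-2}T (ltnSn #|~: T|) => // n IH T ltTn.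
have main : (exists w, binary_flow o T w) ->
    exists P : {poly rat}, forall q, (ntight o T q)%:R = P.[q%:R].
  case=> w wT; pose H := [set c : E * bool | c.2 == ~~ w c.1].
  have HT (A : {set E * bool}) : A \subset H -> A != set0 -> (#|~: (T :|: A)| < n)%N.
    move=> AH /set0Pn[c cA]; apply: leq_trans (_ : #|~: T| <= n)%N => //; apply: proper_card.
    apply/properP; split; first by rewrite setCS subsetUl.
    exists c; last by rewrite !inE cA orbT.
    rewrite inE; apply/negP => cT; have := subsetP AH _ cA.
    by case/andP: wT => _ /forall_inP/(_ _ cT)/eqP h; rewrite inE h; case: (c.2).
  (* The zero polynomial is a filler for the sets [A] that do not occur, so that a choice can be
     made for all [A] at once. *)
  have ex (A : {set E * bool}) : exists P : {poly rat}, A \subset H -> A != set0 ->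
      forall q, (ntight o (T :|: A) q.+1)%:R = P.[q.+1%:R].
    have [/andP[AH A0]|h] := boolP ((A \subset H) && (A != set0)).
      by have [[P PE] _] := IH _ (HT A AH A0); exists P.
    by exists 0 => AH A0; rewrite AH A0 in h.
  have [P PE] := fin_all_exists ex.
  (* By [ntight_shift] the count at [q] is an alternating sum of counts at [q.+1]. Its term for the
     empty [A] is the count on the face itself, so the other terms give the difference. *)
  apply: (@poly_of_difference _ (- \sum_(A : {set E * bool} | (A \subset H) && (A != set0))
     (-1) ^+ #|A| *: P A)) => q.
  rewrite -(ntight_shift q wT) (inclusion_exclusion rat).
  rewrite (bigD1 set0) ?sub0set //= cards0 mul1r.
  have -> : [set x in [set f in box_flows o q.+1 | [forall c in T, tight f c]]
       | [forall t in set0, tight x t]] = [set f in box_flows o q.+1 | [forall c in T, tight f c]].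
    apply/setP => f; rewrite in_set; rewrite [X in _ && X](_ : _ = true) ?andbT //.
    by apply/forall_inP => c; rewrite inE.
  rewrite opprD addNKr hornerN horner_sum; congr (- _); apply: eq_bigr => A /andP[AH A0].
  rewrite hornerZ -PE //; congr (_ * _%:R); apply: eq_card => f; rewrite !inE -andbA.
  congr (_ && _); apply/andP/forall_inP => [[/forall_inP h1 /forall_inP h2] c|h].
    by rewrite inE => /orP[/h1|/h2].
  by split; apply/forall_inP => c cA; apply: h; rewrite inE cA ?orbT.
split=> //; have [w|no] := pselect (exists w, binary_flow o T w).
  by have [P PE] := main w; exists P => q.
exists 0 => q; rewrite horner0 (_ : ntight o T q.+1 = 0%N) //.
apply/eqP; rewrite cards_eq0 -subset0; apply/subsetP => f; rewrite in_set => /andP[ff fT].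
by case: no; apply: tight_binary_flow ff fT.
Qed.

Lemma phibar_rho_poly o : exists P : {poly rat},
  forall q, (phibar_rho src dst o q)%:R = P.[q%:R].
Proof.
have [_ [|P PE]] := ntight_poly o set0.
  exists [ffun=> false]; apply/andP; split.
    rewrite is_flowE (eq_flow (g := fun=> 0)) ?flow0 // => e.
    by rewrite ffunE; case: (o e).
  by apply/forall_inP => c; rewrite inE.
exists P => q; rewrite -PE; congr _%:R; apply: eq_card => f; rewrite !inE.
by rewrite [X in _ && X](_ : _ = true) ?andbT //; apply/forall_inP => c; rewrite inE.
Qed.

Lemma phi_rhoE o q : phi_rho src dst o q.+1 =
  #|[set f in box_flows o q.+1 | [forall c in [set: E * bool], ~~ tight f c]]|.
Proof.
pose F (f : {ffun E -> 'I_q.+1}) : {ffun E -> 'I_q.+2} := [ffun e => inord (f e)].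
have FE f e : F f e = f e :> nat.
  by rewrite ffunE inordK //; have := ltn_ord (f e); lia.
have Finj : injective F.
  move=> f g /ffunP FF; apply/ffunP => e; apply: val_inj => /=.
  by have := congr1 val (FF e); rewrite /= !FE.
rewrite /phi_rho -(card_imset _ Finj); apply: eq_card => g; rewrite !inE.
apply/imsetP/andP.
  case=> f; rewrite !inE => /andP[ff /forallP f0] ->; split.
    by rewrite (eq_is_flow o (g := fun e => (f e : nat)%:Z)) // => e; rewrite FE.
  apply/forall_inP => -[e b] _; rewrite /tight /= FE; case: b; last by rewrite -lt0n f0.
  by rewrite ltn_eqF.
case=> fg /forall_inP gt.
have gq e : (0 < g e < q.+1)%N.
  have := gt (e, false) (in_setT _); have := gt (e, true) (in_setT _).
  rewrite /tight /= lt0n => gq ->; have := ltn_ord (g e).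
  by rewrite ltnS leq_eqVlt (negbTE gq).
exists [ffun e => inord (g e)]; last first.
  by apply/ffunP => e; apply: val_inj; rewrite /= FE ffunE inordK //; case/andP: (gq e).
have gE e : ([ffun e => inord (g e)] : {ffun E -> 'I_q.+1}) e = g e :> nat.
  by rewrite ffunE inordK //; case/andP: (gq e).
rewrite !inE; apply/andP; split.
  by rewrite (eq_is_flow o (g := fun e => (g e : nat)%:Z)) // => e; rewrite gE.
by apply/forallP => e; rewrite gE; have /andP[] := gq e.
Qed.

Lemma phi_rho_poly o : exists P : {poly rat},
  forall q, (phi_rho src dst o q.+1)%:R = P.[q.+1%:R].
Proof.
have ex (A : {set E * bool}) : exists P : {poly rat}, forall q, (ntight o A q.+1)%:R = P.[q.+1%:R].
  by have [] := ntight_poly o A.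
have [P PE] := fin_all_exists ex.
exists (\sum_(A : {set E * bool}) (-1) ^+ #|A| *: P A) => q.
rewrite phi_rhoE (inclusion_exclusion rat) horner_sum.
by apply: eq_big => [A|A _]; rewrite ?subsetT // hornerZ -PE.
Qed.

(** * Reduction modulo q *)

Definition signed q (p : orientation E * {ffun E -> 'I_q.+1}) e : int :=
  if p.1 e then (p.2 e : nat)%:Z else - (p.2 e : nat)%:Z.

Definition rep_flows (R : {set orientation E}) q : {set orientation E * {ffun E -> 'I_q.+1}} :=
  [set p | (p.1 \in R) && (p.2 \in box_flows p.1 q)].

(** With q = [m.+2], box values from 0 to q live in ['I_m.+3] and residues in ['I_m.+2]. *)
Definition residue m (p : orientation E * {ffun E -> 'I_m.+3}) : {ffun E -> 'I_m.+2} :=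
  [ffun e => (signed p e)%:~R].

Definition zeros m (g : {ffun E -> 'I_m.+2}) : {set E} := [set e | g e == 0].

(* The coordinates in which the box of the orientation lies above the flow, among those where
   the flow is on the boundary of the box. *)
Definition side m (p : orientation E * {ffun E -> 'I_m.+3}) : {set E} :=
  [set e in zeros (residue p) | p.1 e (+) (p.2 e == m.+2 :> nat)].

Lemma tc_reps_inj R o1 o2 : tc_reps src dst R -> o1 \in R -> o2 \in R ->
  eul_equiv src dst o1 o2 -> o1 = o2.
Proof.
move=> [/subsetP sR uR] R1 R2 e12; have [r [_ ru]] := uR _ (sR _ R1).
by rewrite -(ru o1) ?(ru o2) //; split=> //; apply: eul_equiv_refl.
Qed.

Lemma mem_rep_flows R q p : p \in rep_flows R q -> p.1 \in R /\ flow (signed p).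
Proof. by rewrite !inE is_flowE => /andP[]. Qed.

Lemma zeros_residue m (p : orientation E * {ffun E -> 'I_m.+3}) e :
  (e \in zeros (residue p)) = (p.2 e == 0 :> nat) || (p.2 e == m.+2 :> nat).
Proof.
rewrite inE ffunE intr_Zp_eq0 dvdzE /= (_ : absz (signed p e) = p.2 e); last first.
  by rewrite /signed; case: (p.1 e); rewrite ?abszN absz_nat.
have := ltn_ord (p.2 e); rewrite ltnS leq_eqVlt => /orP[/eqP ->|lt].
  by rewrite dvdnn eqxx orbT.
rewrite (ltn_eqF lt) orbF; have [->|n0] := eqVneq (p.2 e : nat) 0%N; first exact: dvdn0.
by rewrite gtnNdvd // lt0n.
Qed.

(** Two flows over the same residue differ by q times a flow [y]. Equal sides force [y] to be the
    difference of the orientations, which are then equivalent and hence equal, so [y] is zero. *)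
Lemma side_inj R m g : tc_reps src dst R ->
  {in [set p in rep_flows R m.+2 | residue p == g] &, injective (@side m)}.
Proof.
move=> tcR p1 p2; rewrite inE => /andP[/mem_rep_flows[R1 f1] /eqP g1].
rewrite inE => /andP[/mem_rep_flows[R2 f2] /eqP g2] side12.
have dvd e : (m.+2 %| signed p1 e - signed p2 e)%Z.
  rewrite -intr_Zp_eq0 rmorphB /= subr_eq0.
  by have /ffunP/(_ e) := etrans g1 (esym g2); rewrite !ffunE => /eqP.
pose y e := ((signed p1 e - signed p2 e) %/ m.+2)%Z.
have yE e : signed p1 e - signed p2 e = m.+2%:Z * y e by rewrite mulrC divzK.
have fy : flow y.
  apply: (@flow_div m.+2) => //; rewrite (eq_flow (g := fun e => signed p1 e - signed p2 e)) //.
  exact: flowB.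
have yo e : y e = (p1.1 e)%:R - (p2.1 e)%:R.
  have := yE e; have := zeros_residue p1 e; have := zeros_residue p2 e.
  have /setP/(_ e) := side12; rewrite ![_ \in side _]inE g1 g2 /signed.
  have := ltn_ord (p1.2 e); have := ltn_ord (p2.2 e).
  move: (y e) (p1.2 e : nat) (p2.2 e : nat) => z a b a3 b3.
  case: (e \in zeros g); case: (p1.1 e); case: (p2.1 e) => /=; nia.
have o12 : p1.1 = p2.1.
  apply: (tc_reps_inj tcR) => //; rewrite eul_equivE (eq_flow (g := y)) //.
have s12 e : signed p1 e = signed p2 e.
  by apply/eqP; rewrite -subr_eq0 yE yo o12 subrr mulr0.
clear -o12 s12; case: p1 p2 o12 s12 => [o1 h1] [o2 h2] /= <- s12.
congr (_, _); apply/ffunP => e; apply: val_inj => /=.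
by have := s12 e; rewrite /signed /=; case: (o1 e); lia.
Qed.

(** For a positive flow [z] bounded by [K], the point q z / K is interior to the box of [p.1]; the
    witness points towards it from the flow of [p]. *)
Lemma side_realizable R m p : tc_reps src dst R -> p \in rep_flows R m.+2 ->
  realizable (zeros (residue p)) set0 (side p).
Proof.
move=> [/subsetP sR _] /mem_rep_flows[/sR + fp]; rewrite inE => /totally_cyclic_signs[z fz sz].
have [K K0 zK] := flow_bound z.
exists (fun e => m.+2%:Z * z e + - K * signed p e); split.
- exact: flowD (flowMl _ fz) (flowMl _ fp).
- by apply/vanishP => e; rewrite inE.
- move=> e ez; rewrite inE ez /=; have := sz e; have := zK e.
  move: ez; rewrite zeros_residue /signed.
  by case: (p.1 e) => /= /orP[] /eqP ->; rewrite ?eqxx /=; nia.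
Qed.

(** Perturbing a large multiple of a small lift [h] of [g] by [x] gives a nowhere-zero flow, whose
    signs define a totally cyclic orientation [o] with [h] in its box. *)
Lemma side_onto R m (g : {ffun E -> 'I_m.+2}) (J : {set E}) : tc_reps src dst R ->
  flow g -> J \subset zeros g -> realizable (zeros g) set0 J ->
  exists2 p, p \in [set p in rep_flows R m.+2 | residue p == g] & J = side p.
Proof.
move=> [_ exR] fg Jg [x [fx _ xJ]].
have [h [fh hg hq]] := flow_lift fg; have [K K0 xK] := flow_bound x.
pose z e := K * h e + x e.
pose o : orientation E := [ffun e => 0 < z e].
have fz : flow z by exact: flowD (flowMl _ fh) fx.
have h0 e : (e \in zeros g) = (h e == 0).
  rewrite inE -hg intr_Zp_eq0; apply/idP/eqP => [/dvdzP[k hk]|->]; last exact: dvdz0.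
  have := hq e; rewrite hk => kq; have k1 : -1 < k < 1 by nia.
  by have -> : k = 0 by lia; rewrite mul0r.
have zn0 e : z e != 0.
  rewrite /z; have [ez|ez] := boolP (e \in zeros g).
    have := xJ e ez; move: ez; rewrite h0 => /eqP ->; rewrite mulr0 add0r.
    by case: ifP => _ h'; [rewrite gt_eqF | rewrite lt_eqF].
  by move: ez; rewrite h0; have := xK e; nia.
have sz : signs o z.
  by move=> e; rewrite ffunE; case: ltgtP (zn0 e).
have oT : o \in tc_set src dst by rewrite inE; apply: signs_totally_cyclic fz sz.
have [r [[rR]]] := exR o oT; rewrite eul_equivE => fy _.
(* Subtracting q times [y] carries [h] from the box of [o] to that of the representative [r] without
   changing residues. *)
pose y e : int := (o e)%:R - (r e)%:R.
pose f' e := h e - m.+2%:Z * y e.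
have ff' : flow f' by exact: flowB fh (flowMl _ fy).
have oh e : if o e then 0 <= h e else h e <= 0.
  have := sz e; rewrite /z; have [ez|ez] := boolP (e \in zeros g).
    by move: ez; rewrite h0 => /eqP ->; case: (o e).
  by move: ez; rewrite h0; have := xK e; move: K0; case: (o e); clear; nia.
have fr e : if r e then 0 <= f' e <= m.+2 else - m.+2%:Z <= f' e <= 0.
  by have := hq e; have := oh e; rewrite /f' /y; case: (r e); case: (o e) => /=; clear; lia.
pose f : {ffun E -> 'I_m.+3} := [ffun e => inord (absz (f' e))].
have fE e : f e = absz (f' e) :> nat.
  by rewrite ffunE inordK //; have := fr e; move: (f' e) => t; case: (r e); clear; lia.
have sE : signed (r, f) =1 f'.
  by move=> e; rewrite /signed /= fE; have := fr e; move: (f' e) => t; case: (r e); clear; lia.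
have q0 : (m.+2%:Z)%:~R = 0 :> 'I_m.+2 by apply/eqP; rewrite intr_Zp_eq0.
have rg : residue (r, f) = g.
  by apply/ffunP => e; rewrite ffunE sE rmorphB rmorphM /= q0 mul0r subr0 hg.
exists (r, f).
  by rewrite !inE rg eqxx andbT rR is_flowE -/(signed (r, f)) (eq_flow sE).
apply/setP => e; rewrite [RHS]inE rg.
have [ez|ez] := boolP (e \in zeros g); last by rewrite (contraNF (subsetP Jg e)).
have := xJ e ez; have := sz e; rewrite /z.
move: (ez); rewrite h0 => /eqP he; rewrite he mulr0 add0r /= fE /f' he sub0r /y abszN abszM /=.
by move: (x e) => t; case: (o e); case: (r e); case: (e \in J) => /=; clear; lia.
Qed.

Lemma card_residue_fiber R m (g : {ffun E -> 'I_m.+2}) : tc_reps src dst R -> flow g ->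
  #|[set p in rep_flows R m.+2 | residue p == g]| = nsigns (zeros g) set0.
Proof.
move=> tcR fg; rewrite -(card_in_imset (side_inj (g := g) tcR)).
rewrite /nsigns -sum1_card big_mkcond [RHS]big_mkcond; apply: eq_bigr => J _.
have -> : (J \in [set side p | p in [set p in rep_flows R m.+2 | residue p == g]]) =
    (J \subset zeros g) && `[< realizable (zeros g) set0 J >].
  apply/imsetP/andP => [[p]|[Jg /asboolP rJ]]; last exact: side_onto.
  rewrite inE => /andP[pR /eqP <-] ->; split; last exact/asboolP/side_realizable/pR.
  by apply/subsetP => e; rewrite inE => /andP[].
by case: (J \subset zeros g); case: asboolP.
Qed.

Lemma card_rep_flows (R : {set orientation E}) q (P : forall o, pred {ffun E -> 'I_q.+1}) :
  (\sum_(o in R) #|[set f in box_flows o q | P o f]|)%N =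
  #|[set p in rep_flows R q | P p.1 p.2]|.
Proof.
rewrite -[RHS]sum1_card; under eq_bigr do rewrite -sum1_card.
rewrite pair_big_dep; apply: eq_bigl => -[o f] /=.
by rewrite [RHS]inE [in RHS]inE [in LHS]inE andbA.
Qed.

Lemma sum_residue (R : {set orientation E}) m (P : pred {ffun E -> 'I_m.+2}) : tc_reps src dst R ->
  #|[set p in rep_flows R m.+2 | P (residue p)]| =
  (\sum_(g : {ffun E -> 'I_m.+2} | flow g && P g) nsigns (zeros g) set0)%N.
Proof.
move=> tcR; rewrite -sum1_card.
rewrite (partition_big (@residue m) (fun g => flow g && P g)) => [|p] /=; last first.
  rewrite inE => /andP[/mem_rep_flows[_ fp] ->]; rewrite andbT.
  rewrite (eq_flow (g := fun e => (signed p e)%:~R)) => [|e]; last by rewrite ffunE.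
  exact: flow_mulrz.
apply: eq_bigr => g /andP[fg Pg]; rewrite -(card_residue_fiber tcR fg) -sum1_card.
apply: eq_bigl => p; rewrite !inE; have [->|_] := eqVneq (residue p) g; last by rewrite !andbF.
by rewrite Pg !andbT.
Qed.

(** * The flow polynomial *)

(** Inclusion-exclusion over the sets [A] of edges on which a flow is made to vanish. *)
Definition flow_poly : {poly rat} := \sum_(A : {set E}) (-1) ^+ #|A| *: 'X^(cyc (~: A)).

Lemma nzflow_countE (A : finZmodType) (o : orientation E) :
  nzflow_count src dst A o =
  #|[set f in [set f : {ffun E -> A} | flow f] | [forall e in [set: E], f e != 0]]|.
Proof.
pose F (f : {ffun E -> A}) : {ffun E -> A} := [ffun e => if o e then f e else - f e].
have FK : involutive F.
  by move=> f; apply/ffunP => e; rewrite !ffunE; case: (o e); rewrite ?opprK.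
rewrite /nzflow_count -(card_imset _ (inv_inj FK)); apply: eq_card => g.
have mem f : f \in [set f : {ffun E -> A} | is_flow src dst o f & [forall e, f e != 0]] ->
    F f \in [set f in [set f : {ffun E -> A} | flow f] | [forall e in [set: E], f e != 0]].
  rewrite !inE is_flowE => /andP[ff /forallP f0]; apply/andP; split.
    by rewrite (eq_flow (g := fun e => if o e then f e else - f e)) // => e; rewrite ffunE.
  by apply/forall_inP => e _; rewrite ffunE; case: (o e); rewrite ?oppr_eq0.
apply/imsetP/idP => [[f /mem + ->//]|].
rewrite !inE => /andP[fg /forall_inP g0]; exists (F g); last by rewrite FK.
rewrite inE is_flowE; apply/andP; split.
  rewrite (eq_flow (g := g)) // => e; rewrite ffunE; by case: (o e); rewrite ?opprK.
by apply/forallP => e; rewrite ffunE; case: (o e); rewrite ?oppr_eq0 g0.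
Qed.

Lemma card_flows_vanish (A : finZmodType) Z :
  #|[set f in [set f : {ffun E -> A} | flow f] | [forall e in Z, f e == 0]]| = (#|A| ^ cyc (~: Z))%N.
Proof. by rewrite -card_flows; apply: eq_card => f; rewrite !inE. Qed.

Lemma nzflow_count_poly (A : finZmodType) (o : orientation E) :
  (nzflow_count src dst A o)%:R = flow_poly.[#|A|%:R].
Proof.
rewrite nzflow_countE (inclusion_exclusion rat) horner_sum.
apply: eq_big => [Z|Z _]; first exact: subsetT.
by rewrite card_flows_vanish hornerZ hornerXn natrX.
Qed.

(** Interior points of the boxes are those with nowhere-zero residue, and over such a residue flow
    there is only the empty sign pattern. *)
Lemma sum_phi_rho R m (o : orientation E) : tc_reps src dst R ->
  (\sum_(rho in R) phi_rho src dst rho m.+2)%N = nzflow_count src dst 'I_m.+2 o.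
Proof.
move=> tcR; under eq_bigr do rewrite phi_rhoE.
rewrite card_rep_flows.
have -> : [set p in rep_flows R m.+2 | [forall c in [set: E * bool], ~~ tight p.2 c]] =
    [set p in rep_flows R m.+2 | zeros (residue p) == set0].
  apply/setP => p; rewrite [LHS]inE [RHS]inE; congr (_ && _).
  apply/forall_inP/eqP => [h|h [e b] _].
    apply/setP => e; rewrite zeros_residue inE.
    have := h (e, false) (in_setT _); have := h (e, true) (in_setT _).
    by rewrite /tight /= => /negbTE -> /negbTE ->.
  have /setP/(_ e) := h; rewrite zeros_residue inE /tight /= => /norP[].
  by case: b.
rewrite (sum_residue (fun g => zeros g == set0) tcR) nzflow_countE -sum1_card.
transitivity (\sum_(g : {ffun E -> 'I_m.+2} | flow g && (zeros g == set0)) 1)%N.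
  apply: eq_bigr => g /andP[_ /eqP ->].
  rewrite /nsigns (big_pred1 set0) => [|J]; last by rewrite subset0.
  rewrite asboolT //; exists (fun=> 0); split; first exact: flow0.
    by apply/vanishP.
  by move=> e; rewrite inE.
apply: eq_bigl => g; rewrite !inE; congr (_ && _).
apply/eqP/forall_inP => [/setP h e _|h]; first by have := h e; rewrite !inE => ->.
by apply/setP => e; rewrite !inE (negbTE (h e _)).
Qed.

Lemma flow_poly_oppr (q : rat) : (-1) ^+ cyc setT * flow_poly.[- q] =
  \sum_(A : {set E}) (-1) ^+ (#|A| + cyc setT + cyc (~: A)) * q ^+ cyc (~: A).
Proof.
rewrite horner_sum mulr_sumr; apply: eq_bigr => A _.
rewrite hornerZ hornerXn; move: #|A| (cyc setT) (cyc (~: A)) => i j k.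
by rewrite (exprNn q k) !exprD mulrCA !mulrA.
Qed.

Lemma phibarE R m : tc_reps src dst R ->
  (phibar src dst R m.+2)%:R = (-1) ^+ cyc setT * flow_poly.[- m.+2%:R].
Proof.
move=> tcR; have -> : phibar src dst R m.+2 =
    (\sum_(g : {ffun E -> 'I_m.+2} | flow g) nsigns (zeros g) set0)%N.
  transitivity #|[set p in rep_flows R m.+2 | predT (residue p)]|; last first.
    by rewrite (sum_residue predT tcR); apply: eq_bigl => g; rewrite andbT.
  rewrite -(card_rep_flows R (fun _ => predT)); apply: eq_bigr => o _.
  by apply: eq_card => f; rewrite !inE andbT.
rewrite natr_sum flow_poly_oppr.
have nsE g : (nsigns (@zeros m g) set0)%:R = \sum_(A : {set E} | A \subset zeros g)
    (-1) ^+ (#|A| + cyc setT + cyc (~: A)) :> rat.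
  rewrite nsignsE => [|e _]; last by rewrite inE.
  by apply: eq_bigr => A _; rewrite setC0 set0U.
under eq_bigr do rewrite nsE.
(* For fixed [A], the flows [g] whose zero set contains [A] number q^(cyc (~: A)). *)
rewrite (exchange_big_dep predT) //=; apply: eq_bigr => A _.
pose S := [set f in [set f : {ffun E -> 'I_m.+2} | flow f] | [forall e in A, f e == 0]].
rewrite (eq_bigl (mem S)) => [|g]; last first.
  rewrite !inE; congr (_ && _); apply/subsetP/forall_inP => h e eA.
    by have := h e eA; rewrite inE.
  by rewrite inE h.
by rewrite sumr_const card_flows_vanish card_ord -[LHS]mulr_natr natrX.
Qed.

(** * Degree and special values *)

Lemma cyc_mono B B' : B \subset B' -> (cyc B <= cyc B')%N.
Proof.
move=> sB; pose S C := [set f : {ffun E -> 'I_2} | flow f & vanish (~: C) f].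
have : (#|S B| <= #|S B'|)%N; last by rewrite !card_flows !setCK card_ord leq_exp2l.
apply: subset_leq_card; apply/subsetP => f; rewrite !inE => /andP[-> /vanishP f0] /=.
by apply/vanishP => e eB'; apply: f0; move: eB'; rewrite !inE; apply/contra/subsetP.
Qed.

(** Without bridges, deleting any edge lowers [cyc], so only the term of the empty set reaches the
    top degree. *)
Lemma size_flow_poly : bridgeless src dst -> size flow_poly = (cyc setT).+1.
Proof.
move=> bl; rewrite /flow_poly (bigD1 set0) //= cards0 scale1r setC0.
rewrite size_polyDl size_polyXn // ltnS.
apply: leq_trans (size_sum _ _ _) _; apply/bigmax_leqP => A /set0Pn[e eA].
apply: leq_trans (size_scale_leq _ _) _; rewrite size_polyXn.
have eT : e |: [set~ e] = [set: E] by apply/setP => e'; rewrite !inE orbN.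
have eN : e \notin [set~ e] by rewrite !inE eqxx.
have := cyc_linked eN (bridgelessE (bl e)); rewrite eT => ->.
by rewrite ltnS cyc_mono // setCS sub1set.
Qed.

Lemma card_tc_set : #|tc_set src dst| = nsigns setT set0.
Proof.
pose F (J : {set E}) : orientation E := [ffun e => e \in J].
have Finj : injective F.
  by move=> J J' /ffunP h; apply/setP => e; have := h e; rewrite !ffunE.
rewrite /nsigns (eq_bigl predT) => [|J]; last exact: subsetT.
rewrite -big_mkcond sum1_card -[RHS](card_imset _ Finj); apply: eq_card => o.
apply/idP/imsetP => [|[J + ->]].
  rewrite inE => /totally_cyclic_signs[z fz sz]; exists [set e | o e].
    apply/asboolP; exists z; split=> // [|e _]; last by rewrite inE; apply: sz.
    by apply/vanishP => e; rewrite inE.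
  by apply/ffunP => e; rewrite ffunE inE.
move=> /asboolP[x [fx _ xs]]; rewrite inE; apply: (signs_totally_cyclic fx) => e.
by rewrite ffunE; apply: xs; rewrite inE.
Qed.

(** Totally cyclic orientations are the full sign patterns of integer flows, and at q = 1 the
    expansion of [flow_poly_oppr] is exactly their count. *)
Lemma flow_polyN1 : `|flow_poly.[-1]| = #|tc_set src dst|%:R.
Proof.
have tcE : #|tc_set src dst|%:R = (-1) ^+ cyc setT * flow_poly.[-1] :> rat.
  rewrite card_tc_set flow_poly_oppr nsignsE => [|e _]; last by rewrite inE.
  apply: eq_big => [A|A _]; first by rewrite subsetT.
  by rewrite setC0 set0U expr1n mulr1.
by rewrite -[RHS]normr_nat tcE normrM normrX normrN1 expr1n mul1r.
Qed.

Lemma eul_classE o1 o2 :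
  (eul_class src dst o1 == eul_class src dst o2) = eul_equiv src dst o1 o2.
Proof.
apply/eqP/idP => [/setP/(_ o2)|e12]; first by rewrite !inE eul_equiv_refl.
apply/setP => o; rewrite !inE; apply/idP/idP; apply: eul_equiv_trans => //.
by rewrite eul_equiv_sym.
Qed.

Lemma card_tc_reps R : tc_reps src dst R -> #|R| = n_tc_classes src dst.
Proof.
move=> tcR; have [/subsetP sR exR] := tcR.
have inj : {in R &, injective (eul_class src dst)}.
  by move=> o1 o2 R1 R2 /eqP; rewrite eul_classE; apply: (tc_reps_inj tcR).
rewrite -(card_in_imset inj); apply: eq_card => c; apply/imsetP/imsetP => -[o].
  by move=> /sR oT ->; exists o.
move=> /exR[r [[rR or] _]] ->; exists r => //.
by apply/eqP; rewrite eul_classE.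
Qed.

Lemma tc_reps_exist : exists R, tc_reps src dst R.
Proof.
pose rp o := odflt o [pick r in tc_set src dst | eul_class src dst r == eul_class src dst o].
have rpP o : o \in tc_set src dst -> rp o \in tc_set src dst /\ eul_equiv src dst o (rp o).
  move=> oT; rewrite /rp; case: pickP => [r /andP[rT]|/(_ o)] /=.
    by rewrite eul_classE eul_equiv_sym.
  by rewrite oT eqxx.
have rpE o1 o2 : o1 \in tc_set src dst -> eul_equiv src dst o1 o2 -> rp o1 = rp o2.
  rewrite -eul_classE => oT /eqP e12; rewrite /rp e12.
  by case: pickP => // /(_ o1); rewrite oT e12 eqxx.
exists [set rp o | o in tc_set src dst]; split.
  by apply/subsetP => _ /imsetP[o oT ->]; case: (rpP o oT).
move=> o oT; exists (rp o); split; first by split; [exact: imset_f | case: (rpP o oT)].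
move=> _ [/imsetP[o' o'T ->] e1]; apply: rpE => //; apply: eul_equiv_trans e1 _.
by rewrite eul_equiv_sym; case: (rpP o' o'T).
Qed.

Lemma phibar0 R : phibar src dst R 0 = #|R|.
Proof.
rewrite /phibar -sum1_card; apply: eq_bigr => o _; rewrite /phibar_rho.
rewrite (_ : [set f | _] = setT) ?cardsT ?card_ffun ?card_ord ?exp1n //.
apply/setP => f; rewrite !inE is_flowE (eq_flow (g := fun=> 0)) ?flow0 // => e.
by rewrite (ord1 (f e)); case: (o e).
Qed.

End Flows.

Theorem theorem1p2 (V E : finType) (src dst : E -> V) :
  bridgeless src dst ->
  exists (Pphi Pbar : {poly rat}),
    [/\ size Pphi = (cyclo src dst).+1 /\ size Pbar = (cyclo src dst).+1,
        (* phi(G,q) = Pphi(q) for every abelian group of order q and every orientation *)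
        (forall (A : finZmodType) (o : orientation E),
            (nzflow_count src dst A o)%:R = Pphi.[(#|A|)%:R]),
        (* bar phi(G,q) = Pbar(q) for all q >= 0, any choice of representatives *)
        (forall R : {set orientation E}, tc_reps src dst R ->
            forall q : nat, (phibar src dst R q)%:R = Pbar.[q%:R])
        (* reciprocity: phi(G,-t) = (-1)^n(G) bar phi(G,t) *)
        /\ Pphi \Po (- 'X) = (-1) ^+ (cyclo src dst) *: Pbar,
        (* decomposition over representatives *)
        (forall R : {set orientation E}, tc_reps src dst R ->
           exists (F Fb : orientation E -> {poly rat}),
             [/\ (forall rho, rho \in R -> forall q : nat, (0 < q)%N ->
                    (phi_rho src dst rho q)%:R = (F rho).[q%:R]),
                 (forall rho, rho \in R -> forall q : nat,
                    (phibar_rho src dst rho q)%:R = (Fb rho).[q%:R]),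
                 Pphi = \sum_(rho in R) F rho &
                 Pbar = \sum_(rho in R) Fb rho]) &
        `|Pphi.[-1]| = (#|tc_set src dst|)%:R /\
        `|Pphi.[0]| = (n_tc_classes src dst)%:R].
Proof.
move=> bl; rewrite -cyc_setT; set n := cyc src dst setT.
(* [Pb] is defined by the reciprocity law; what remains is that it counts the closed boxes. *)
pose P := flow_poly src dst; pose Pb := (-1) ^+ n *: (P \Po (- 'X)).
have [F FE] := fin_all_exists (phi_rho_poly src dst).
have [Fb FbE] := fin_all_exists (phibar_rho_poly src dst).
have PbE R : tc_reps src dst R -> Pb = \sum_(rho in R) Fb rho.
  move=> tcR; apply: eq_poly_nat => m; rewrite /Pb hornerZ horner_comp hornerN hornerX.
  by rewrite -(phibarE m tcR) /phibar natr_sum horner_sum; apply: eq_bigr => o _; rewrite FbE.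
(* [phibarE] only treats q from 2 on; polynomiality of each [phibar_rho] extends the identity to 0
   and 1. *)
have barE R : tc_reps src dst R -> forall q : nat, (phibar src dst R q)%:R = Pb.[q%:R].
  move=> tcR q; rewrite (PbE R tcR) /phibar natr_sum horner_sum.
  by apply: eq_bigr => o _; rewrite FbE.
have sP : size P = n.+1 by exact: size_flow_poly.
exists P, Pb; split.
- split=> //; rewrite size_scale ?signr_eq0 // size_comp_poly2 //.
  by rewrite size_polyN size_polyX.
- exact: nzflow_count_poly.
- by split=> //; rewrite /Pb scalerA -exprD addnn -signr_odd odd_double scale1r.
- move=> R tcR; exists F, Fb; split=> [rho _ [//|q] _|rho _ q||].
  + exact: FE.
  + exact: FbE.
  + apply: eq_poly_nat => m.
    have := nzflow_count_poly src dst 'I_m.+2 [ffun=> true]; rewrite card_ord => <-.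
    rewrite -(sum_phi_rho m [ffun=> true] tcR) natr_sum horner_sum.
    by apply: eq_bigr => o _; rewrite FE.
  + exact: PbE.
- split; first exact: flow_polyN1.
  have [R tcR] := tc_reps_exist src dst.
  have := barE R tcR 0%N; rewrite phibar0 (card_tc_reps tcR) => Pb0.
  rewrite -normr_nat Pb0 /Pb hornerZ normrM normrX normrN1 expr1n mul1r.
  by rewrite horner_comp hornerN hornerX oppr0.
Qed.
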